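(* Let $m>1$, $0<\kappa\le1$ and $\gamma\in\Gamma(\kappa)$. If $s>\frac14$, then for every $f\in H^s(\mathbb R)$, $$\dim_c(\mathfrak D(\gamma,f))\le\max\left\{1-2s,\frac{1-2s}{m\kappa}\right\}.$$
   Context: For $0<\kappa\le1$, $\Gamma(\kappa)$ is the collection of continuous functions $\gamma:\mathbb R\times[-1,1]\to\mathbb R$ with $\gamma(x,0)=x$ for which there are constants $C_1,C_2>0$ such that $|\gamma(x,t)-\gamma(x,t')|\le C_1|t-t'|^\kappa$ for all $x\in\mathbb R$, $t,t'\in[-1,1]$, and $\frac1{C_2}|x-x'|\le|\gamma(x,t)-\gamma(x',t)|\le C_2|x-x'|$ for all $t\in[-1,1]$, $x,x'\in\mathbb R$. $H^s(\mathbb R)$ is the Sobolev space of order $s$ with norm $\|f\|_{H^s}=\|(1-\Delta)^{s/2}f\|_{L^2(\mathbb R)}$, and $\widehat f(\xi)=\int_{\mathbb R}e^{-ix\xi}f(x)\,dx$. The evolution operator $S_t=e^{it(-\Delta)^{m/2}}$ (giving the formal solution of the fractional Schrödinger equation $i\partial_tu+(-\Delta)^{m/2}u=0$ with $u(\cdot,0)=f$) is defined on appropriate input functions by $$S_tf(x)=\frac1{2\pi}\int_{\mathbb R}e^{i(x\xi+t|\xi|^m)}\widehat f(\xi)\,d\xi .$$ For $f\in H^s(\mathbb R)$ and $\gamma\in\Gamma(\kappa)$, the divergence set is $$\mathfrak D(\gamma,f)=\{x\in\mathbb R: S_tf(\gamma(x,t))\not\to f(x)\text{ as }t\to0\}.$$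 For $0<\alpha\le1$, a positive Borel measure $\mu$ on $\mathbb R$ is called $\alpha$-dimensional if there is a constant $c$ such that $\mu(\mathbb B(x,r))\le c\,r^\alpha$ for all $x\in\mathbb R$ and $r>0$, where $\mathbb B(x,r)$ is the ball (interval) centered at $x$ with radius $r$. For $X\subset\mathbb R$, $\mathcal M^\alpha(X)$ is the set of $\alpha$-dimensional measures $\mu$ with $0<\mu(X)<\infty$, and the capacitary dimension of $X$ is $\dim_c(X)=\sup\{\alpha:\mathcal M^\alpha(X)\neq\emptyset\}$. *)

(* Defs.v *)
From mathcomp Require Import all_boot all_order all_algebra.
From mathcomp Require Import all_classical all_reals all_analysis.
From mathcomp Require Import complex.

Set Implicit Arguments.
Unset Strict Implicit.
Unset Printing Implicit Defensive.

Import Order.TTheory GRing.Theory Num.Theory.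
Import numFieldNormedType.Exports.

Local Open Scope classical_set_scope.
Local Open Scope complex_scope.
Local Open Scope ring_scope.

(* Conventions (MathComp-Analysis, R : realType).
   - Complex-valued functions take values in R[i]; limits of complex values are
     taken in R[i]^o, the same type carrying the topology of its norm.
   - For f in L^2 the Fourier transform is the L^2 limit of the truncated
     integrals.  Its integral against e^{i(x xi + t|xi|^m)} over the line need
     not converge absolutely when s <= 1/2; an integral over the whole line is
     read as the limit as N -> oo of the integrals over [-N, N].
   - An element of H^s is a class of a.e. equal functions, so f(x) is read, in
     the same way, as the value at x of the Fourier inversion integral. *)

Section Curves.
Variable R : realType.

(* gamma is only ever used on R x [-1, 1]. *)
Definition Gamma (kappa : R) (gamma : R -> R -> R) : Prop :=
  [/\ {within [set p : R * R | -1 <= p.2 <= 1],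
        continuous (fun p : R * R => gamma p.1 p.2)},
      (forall x, gamma x 0 = x)
    & exists C1 C2 : R, [/\ 0 < C1, 0 < C2,
        (forall x t t' : R, -1 <= t <= 1 -> -1 <= t' <= 1 ->
           `|gamma x t - gamma x t'| <= C1 * (`|t - t'| `^ kappa))
      & (forall t x x' : R, -1 <= t <= 1 ->
           C2^-1 * `|x - x'| <= `|gamma x t - gamma x' t| <= C2 * `|x - x'|)]].

End Curves.

Section FourierSobolev.
Variable R : realType.
Implicit Types (f g h : R -> R[i]) (x t xi s m N l : R).

Definition expi (theta : R) : R[i] := cos theta +i* sin theta.

Definition cintegral (A : set R) h : R[i] :=
  (\int[lebesgue_measure]_(x in A) complex.Re (h x))%R +i*
  (\int[lebesgue_measure]_(x in A) complex.Im (h x))%R.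

Definition cmeasurable h : Prop :=
  measurable_fun setT (fun x => complex.Re (h x)) /\
  measurable_fun setT (fun x => complex.Im (h x)).

(* The squared L^2 norm, possibly +oo. *)
Definition L2norm2 h : \bar R :=
  (\int[lebesgue_measure]_x (Normc.normc (h x) ^+ 2)%:E)%E.

Definition in_L2 h : Prop := cmeasurable h /\ (L2norm2 h < +oo)%E.

Definition truncated_fourier f N xi : R[i] :=
  cintegral `[- N, N] (fun x => expi (- (x * xi)) * f x).

Definition is_fourier f g : Prop :=
  in_L2 g /\
  L2norm2 (fun xi => truncated_fourier f N xi - g xi) @[N --> +oo] --> 0%E.

(* Well defined up to a null set for f in L^2 (Plancherel). *)
Definition fourier f : R -> R[i] := xget (fun=> 0) [set g | is_fourier f g].

(* h = (1 - Delta)^{s/2} f, as the Fourier multiplier of symbol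
   (1 + xi^2)^{s/2}. *)
Definition is_bessel_potential s f h : Prop :=
  {ae lebesgue_measure, forall xi,
     fourier h xi = ((1 + xi ^+ 2) `^ (s / 2))%:C * fourier f xi}.

(* H^s for s >= 0, where H^s is contained in L^2. *)
Definition in_sobolev s f : Prop :=
  in_L2 f /\ exists h, in_L2 h /\ is_bessel_potential s f h.

Definition line_integral_cvg h : Prop :=
  cvg ((cintegral `[- N, N] h : R[i]^o) @[N --> +oo]).

Definition line_integral h : R[i] :=
  lim ((cintegral `[- N, N] h : R[i]^o) @[N --> +oo]).

Definition inversion_integrand f x xi : R[i] :=
  ((2 * pi)^-1)%:C * (expi (x * xi) * fourier f xi).

Definition evolution_integrand m f t x xi : R[i] :=
  ((2 * pi)^-1)%:C * (expi (x * xi + t * (`|xi| `^ m)) * fourier f xi).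

Definition point_value f x : R[i] := line_integral (inversion_integrand f x).

Definition evolution m f t x : R[i] :=
  line_integral (evolution_integrand m f t x).

(* S_t f(gamma(x,t)) -> f(x) includes the requirement that both sides be
   defined (for t near 0), so that points where they are not belong to the
   divergence set. *)
Definition converges_along (gamma : R -> R -> R) m f x : Prop :=
  [/\ line_integral_cvg (inversion_integrand f x),
      (\forall t \near 0^',
         line_integral_cvg (evolution_integrand m f t (gamma x t)))
    & (evolution m f t (gamma x t) : R[i]^o) @[t --> 0^'] -->
      (point_value f x : R[i]^o)].

Definition divergence_set (gamma : R -> R -> R) m f : set R :=
  [set x | ~ converges_along gamma m f x].

End FourierSobolev.

Section CapacitaryDimension.
Variable R : realType.

Definition alpha_dimensional (alpha : R) (mu : {measure set R -> \bar R}) :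
    Prop :=
  exists c : R, forall x r : R, 0 < r ->
    (mu (ball x r) <= (c * (r `^ alpha))%:E)%E.

(* mu_ext mu is the outer measure of mu; it equals mu on Borel sets and
   gives mu(X) a meaning for an arbitrary X. *)
Definition frostman_measures (alpha : R) (X : set R) :
    set {measure set R -> \bar R} :=
  [set mu | alpha_dimensional alpha mu /\
            (0 < mu_ext mu X)%E /\ (mu_ext mu X < +oo)%E].

(* A supremum in the extended reals: the supremum of the empty set is -oo. *)
Definition dim_c (X : set R) : \bar R :=
  ereal_sup [set alpha%:E | alpha in
    [set alpha : R | 0 < alpha <= 1 /\ frostman_measures alpha X !=set0]].

End CapacitaryDimension.

(* Main.v *)
Require Import Defs.
From mathcomp Require Import all_boot all_order all_algebra.
From mathcomp Require Import all_classical all_reals all_analysis.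
From mathcomp Require Import measurable_realfun complex ring lra.

(** Nothing about the Fourier transform is needed beyond the integrability of
    [(1 + xi^2)^s |g|^2] for [g = fourier f].  It suffices to bound, outside a
    null set of [x], the integrals of [g(xi) e^{i(gamma(x,t) xi + t |xi|^m)}]
    over [M < |xi| <= N] uniformly in [N >= M] and [|t| <= 1]: then the
    truncated integrals are uniformly Cauchy, and their limits are continuous
    in [t].

    The exceptional set is controlled by the Kolmogorov-Seliverstov-Plessner
    method.  A large value in each of finitely many small cells selects points
    [x_i], times [t_i] and cutoffs [N_i]; duality then leads to the
    kernels [int |xi|^{-q} cos(X xi + T |xi|^m)], [1/2 < q < 1], [q <= 2 s],
    with [X = gamma(x_i,t_i) - gamma(x_j,t_j)] and [T = t_i - t_j].  By van der
    Corput's lemma they are [O(|X|^{q-1})] and [O(|T|^{(q-1)/m})], uniformly in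
    the cutoffs.  As either [|X| >~ |x_i - x_j|] or
    [|T|^kappa >~ |x_i - x_j|], they are [O(|x_i - x_j|^{-beta})] with
    [beta = max(1 - q, (1 - q) / (m kappa))], and the energies of order [beta]
    of an [alpha]-dimensional measure are finite when [alpha > beta].  Working
    with cells instead of integrating against the measure avoids Fubini's
    theorem and measurable selections. *)

Set Implicit Arguments.
Unset Strict Implicit.
Unset Printing Implicit Defensive.

Import Order.TTheory GRing.Theory Num.Theory.
Import numFieldNormedType.Exports.
Local Open Scope classical_set_scope.
Local Open Scope ring_scope.

(** * Van der Corput's lemma *)

Section Derivatives.
Variable R : realType.
Implicit Types (f g F V : R -> R) (u v x : R).

Lemma is_derive1_mul f g x df dg : is_derive x 1 f df -> is_derive x 1 g dg ->
  is_derive x 1 (fun y => f y * g y) (df * g x + f x * dg).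
Proof.
move=> hf hg; have h := is_deriveM hf hg.
by apply: (is_derive_eq h); rewrite /GRing.scale /=; ring.
Qed.

Lemma is_derive1_inv f x df : f x != 0 -> is_derive x 1 f df ->
  is_derive x 1 (fun y => (f y)^-1) (- (df / f x ^+ 2)).
Proof.
move=> fx0 hf; have h := is_deriveV fx0 hf.
by apply: (is_derive_eq h); rewrite /GRing.scale /= mulNr mulrC.
Qed.

Lemma is_derive1_within_continuous F dF u v :
  (forall x, u <= x <= v -> is_derive x 1 F (dF x)) ->
  {within `[u, v], continuous F}.
Proof.
move=> dFP; apply: derivable_within_continuous => x.
by rewrite in_itv /= => /dFP [].
Qed.

Lemma is_derive1_ndecr V dV u v : u <= v ->
  (forall x, u <= x <= v -> is_derive x 1 V (dV x)) ->
  (forall x, u <= x <= v -> 0 <= dV x) -> V u <= V v.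
Proof.
move=> uv dVP dV0.
have [c] := @MVT_segment R V dV u v uv
  (fun x hx => dVP x (subset_itv_oo_cc hx)) (is_derive1_within_continuous dVP).
rewrite in_itv /= => /dV0 dVc e.
by rewrite -subr_ge0 e mulr_ge0 // subr_ge0.
Qed.

(** Both [V - F] and [V + F] are nondecreasing. For antiderivatives, this plays the part of bounding
    an integral by the integral of a majorant. *)
Lemma is_derive1_dist_le F dF V dV u v : u <= v ->
  (forall x, u <= x <= v -> is_derive x 1 F (dF x)) ->
  (forall x, u <= x <= v -> is_derive x 1 V (dV x)) ->
  (forall x, u <= x <= v -> `|dF x| <= dV x) -> `|F v - F u| <= V v - V u.
Proof.
move=> uv dFP dVP le.
have h1 : V u - F u <= V v - F v.
  apply: (@is_derive1_ndecr (fun x => V x - F x) (fun x => dV x - dF x)) => //.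
    by move=> x hx; have := dFP x hx; have := dVP x hx => ? ?; apply: is_deriveB.
  by move=> x /le; rewrite ler_norml subr_ge0 => /andP[].
have h2 : V u + F u <= V v + F v.
  apply: (@is_derive1_ndecr (fun x => V x + F x) (fun x => dV x + dF x)) => //.
    by move=> x hx; have := dFP x hx; have := dVP x hx => ? ?; apply: is_deriveD.
  by move=> x /le; rewrite ler_norml => /andP[]; lra.
by rewrite ler_norml; apply/andP; split; lra.
Qed.

(* Integration by parts: [Phi - (psi / phi') sin phi] has derivative
   [- (psi / phi')' sin phi], dominated by that of
   [- psi / lam - psi(u) / phi']. *)
Lemma van_der_corput (phi dphi ddphi psi dpsi Phi : R -> R) (lam u v : R) :
  u <= v -> 0 < lam ->
  (forall x, u <= x <= v -> is_derive x 1 phi (dphi x)) ->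
  (forall x, u <= x <= v -> is_derive x 1 dphi (ddphi x)) ->
  (forall x, u <= x <= v -> is_derive x 1 psi (dpsi x)) ->
  (forall x, u <= x <= v -> is_derive x 1 Phi (psi x * cos (phi x))) ->
  (forall x, u <= x <= v -> 0 <= ddphi x) ->
  (forall x, u <= x <= v -> 0 <= psi x) ->
  (forall x, u <= x <= v -> dpsi x <= 0) ->
  (forall x, u <= x <= v -> lam <= dphi x) \/
  (forall x, u <= x <= v -> dphi x <= - lam) ->
  `|Phi v - Phi u| <= 4 * psi u / lam.
Proof.
move=> uv lam0 Dphi Ddphi Dpsi DPhi ddphi0 psi0 dpsi0 hlam.
have uu : u <= u <= v by rewrite lexx.
have vv : u <= v <= v by rewrite lexx uv.
have absphi x : u <= x <= v -> lam <= `|dphi x|.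
  case: hlam => h /h; last first.
    move=> hx; rewrite ler0_norm; lra.
  move=> hx; rewrite ger0_norm; lra.
have dphi_neq0 x : u <= x <= v -> dphi x != 0.
  by move=> /absphi h; rewrite -normr_gt0; apply: lt_le_trans h.
have psi_le x : u <= x <= v -> psi x <= psi u.
  move=> /andP[ux xv].
  have sub y : u <= y <= x -> u <= y <= v.
    by move=> /andP[-> h]; rewrite (le_trans h xv).
  have := @is_derive1_ndecr (fun y => - psi y) (fun y => - dpsi y) u x ux.
  rewrite lerN2; apply.
    by move=> y /sub hy; have ? := Dpsi y hy; apply: is_deriveN.
  by move=> y /sub hy; rewrite oppr_ge0 dpsi0.
have invphi x : u <= x <= v -> `|(dphi x)^-1| <= lam^-1.
  move=> hx; rewrite normfV lef_pV2 ?posrE ?absphi//.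
  by apply: lt_le_trans (absphi _ hx).
pose W x := psi x * (dphi x)^-1.
pose dW x := dpsi x * (dphi x)^-1 - psi x * (ddphi x / dphi x ^+ 2).
have DW x : u <= x <= v -> is_derive x 1 W (dW x).
  move=> hx; have h := is_derive1_inv (dphi_neq0 x hx) (Ddphi x hx).
  apply: (is_derive_eq (is_derive1_mul (Dpsi x hx) h)).
  by rewrite /dW; ring.
pose S x := sin (phi x).
have DS x : u <= x <= v -> is_derive x 1 S (cos (phi x) * dphi x).
  by move=> hx; apply: (is_derive1_comp (is_derive_sin (phi x)) (Dphi x hx)).
pose H x := Phi x - W x * S x.
pose dH x := - (dW x * S x).
have DH x : u <= x <= v -> is_derive x 1 H (dH x).
  move=> hx; have h1 := DPhi x hx.
  have h2 := is_derive1_mul (DW x hx) (DS x hx).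
  apply: (is_derive_eq (is_deriveB h1 h2)).
  rewrite /dH /W; field; exact: dphi_neq0.
pose V x := - (psi x / lam) - psi u * (dphi x)^-1.
pose dV x := - (dpsi x / lam) + psi u * (ddphi x / dphi x ^+ 2).
have DV x : u <= x <= v -> is_derive x 1 V (dV x).
  move=> hx; have h := is_derive1_inv (dphi_neq0 x hx) (Ddphi x hx).
  have h1 := is_derive1_mul (is_derive_cst (psi u) x 1) h.
  have h2 := is_derive1_mul (Dpsi x hx) (is_derive_cst lam^-1 x 1).
  apply: (is_derive_eq (is_deriveB (is_deriveN h2) h1)).
  by rewrite /dV /cst /=; ring.
have HV : `|H v - H u| <= V v - V u.
  apply: is_derive1_dist_le uv DH DV _ => x hx.
  rewrite /dH normrN normrM.
  have sle : `|S x| <= 1 by rewrite ler_norml sin_geN1 sin_le1.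
  apply: le_trans (ler_wpM2l (normr_ge0 _) sle) _; rewrite mulr1.
  apply: le_trans (ler_normB _ _) _; apply: lerD.
    rewrite normrM (ler0_norm (dpsi0 x hx)) -mulNr.
    by apply: ler_wpM2l; rewrite ?oppr_ge0 ?dpsi0// invphi.
  rewrite normrM (ger0_norm (psi0 x hx)) ger0_norm.
    by apply: ler_wpM2r; rewrite ?psi_le// divr_ge0 ?ddphi0 ?sqr_ge0.
  by rewrite divr_ge0 ?ddphi0 ?sqr_ge0.
have psiu0 := psi0 u uu.
have il0 : 0 < lam^-1 by rewrite invr_gt0.
have VV : V v - V u <= 2 * (psi u / lam).
  have a1 : 0 <= psi v / lam by apply: mulr_ge0; [exact: psi0|exact: ltW].
  (* [dphi] keeps one sign, so both reciprocals lie on the same side of 0 and their difference costs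
     [lam^-1] rather than twice that. *)
  have a2 : (dphi u)^-1 - (dphi v)^-1 <= lam^-1.
    have := invphi u uu; have := invphi v vv.
    rewrite !ler_norml => /andP[p1 p2] /andP[p3 p4].
    case: hlam => h.
      have : 0 < (dphi v)^-1 by rewrite invr_gt0; have := h v vv; lra.
      lra.
    have : (dphi u)^-1 < 0 by rewrite invr_lt0; have := h u uu; lra.
    lra.
  have := ler_wpM2l psiu0 a2; rewrite /V; lra.
(* The two boundary terms of the integration by parts supply the other half of the constant 4. *)
have WS x : u <= x <= v -> `|W x * S x| <= psi u / lam.
  move=> hx; rewrite normrM -[leRHS]mulr1; apply: ler_pM => //.
    rewrite normrM (ger0_norm (psi0 x hx)).
    by apply: ler_pM; rewrite ?psi0 ?psi_le ?invphi.
  by rewrite ler_norml sin_geN1 sin_le1.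
have := WS u uu; have := WS v vv; move: HV VV.
rewrite /H !ler_norml => /andP[b1 b2] b3 /andP[b4 b5] /andP[b6 b7].
by apply/andP; split; lra.
Qed.

End Derivatives.

(** * The oscillatory kernel *)

Section OscillatoryKernel.
Variables (R : realType) (q m : R).
Hypotheses (hq : 1 / 2 < q) (hq1 : q < 1) (hm : 1 < m).
Implicit Types (D : R -> Prop) (X T B a b c : R).

Lemma powR_le_base_neg (r x y : R) : r <= 0 -> 0 < x -> x <= y ->
  y `^ r <= x `^ r.
Proof.
move=> r0 x0 xy; have y0 : 0 < y by apply: lt_le_trans xy.
rewrite -[r]opprK powRN [leRHS]powRN lef_pV2 ?posrE ?powR_gt0//.
by apply: ge0_ler_powR; rewrite ?nnegrE ?oppr_ge0 //; exact: ltW.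
Qed.

Lemma powR_le_base (r x y : R) : 0 <= r -> 0 <= x -> x <= y ->
  x `^ r <= y `^ r.
Proof.
by move=> r0 x0 xy; apply: ge0_ler_powR; rewrite ?nnegrE// (le_trans x0).
Qed.

Lemma powR_lt_base (r x y : R) : 0 < r -> 0 <= x -> x < y ->
  x `^ r < y `^ r.
Proof.
move=> r0 x0 xy; apply: gt0_ltr_powR; rewrite ?nnegrE//.
exact: ltW (le_lt_trans x0 xy).
Qed.

Lemma powR_div (r x y : R) : 0 <= x -> 0 < y ->
  (x / y) `^ r = x `^ r / y `^ r.
Proof.
move=> x0 y0; rewrite powRM ?invr_ge0 ?(ltW y0)//; congr (_ * _).
by rewrite -(powR_inv1 (ltW y0)) -powRrM mulN1r powRN.
Qed.

Lemma powR_gt1 (r x : R) : 0 < r -> 1 < x -> 1 < x `^ r.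
Proof.
move=> r0 x1; have /(_ r) e := fun r => congr1 (@^~ r) (@powR1 R).
by rewrite -[ltLHS]e; apply: powR_lt_base.
Qed.

Lemma powR_lt1 (r x : R) : 0 < r -> 0 <= x -> x < 1 -> x `^ r < 1.
Proof.
move=> r0 x0 x1; have /(_ r) e := fun r => congr1 (@^~ r) (@powR1 R).
by rewrite -[ltRHS]e; apply: powR_lt_base.
Qed.

(** For [1 <= p] compare [x ^ p] with [x]; for [p < 1] the function [y ^ p - p y] is nondecreasing
    on [[x, 1]]. The bound measures how fast the phase derivative leaves 0 near a stationary
    point. *)
Lemma powR_chord_le (p x : R) : 0 < p -> 0 < x <= 1 ->
  Num.min 1 p * (1 - x) <= 1 - x `^ p.
Proof.
move=> p0 /andP[x0 x1].
have [p1|p1] := leP 1 p.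
  by rewrite mul1r lerD2l lerN2 ge1r_powR ?x0.
have := @is_derive1_ndecr R (fun y => y `^ p - p * y)
  (fun y => p * y `^ (p - 1) - p) x 1 x1.
rewrite powR1 mulr1 => h.
suff : x `^ p - p * x <= 1 - p by lra.
apply: h => y /andP[xy y1].
  have y0 : 0 < y by apply: lt_le_trans xy.
  have h1 := is_derive1_powR p y0.
  have h2 := is_derive1_mul (is_derive_cst p y 1) (is_derive_id y 1).
  apply: (is_derive_eq (is_deriveB h1 h2)); rewrite /cst /=; ring.
have y0 : 0 < y by apply: lt_le_trans xy.
rewrite subr_ge0 -{1}[p]mulr1 ler_pM2l// -[leLHS](powRr0 y).
by apply: ger_powR; rewrite ?y0 ?y1//; lra.
Qed.

(** An antiderivative [Phi] stands for the oscillatory integral, so splitting and rescaling need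
    only derivatives. [D] restricts the endpoints only, and [B] is uniform in the phase shift
    [theta]. *)
Definition osc_on D X T B : Prop :=
  forall (theta : R) (Phi : R -> R) (u v : R), 0 < u -> u <= v -> D u -> D v ->
    (forall x, u <= x <= v ->
       is_derive x 1 Phi (x `^ (- q) * cos (X * x + T * x `^ m + theta))) ->
    `|Phi v - Phi u| <= B.

Definition osc_bound := osc_on (fun=> True).

Lemma osc_on_le D X T B B' : B <= B' -> osc_on D X T B -> osc_on D X T B'.
Proof. by move=> BB h th Phi u v *; apply: le_trans BB; apply: h. Qed.

(** When [c] falls outside the interval, a single bound applies, and the nonnegative other one is
    added for free. *)
Lemma osc_on_glue c (D D1 D2 : R -> Prop) X T B1 B2 :
  0 <= B1 -> 0 <= B2 -> D1 c -> D2 c ->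
  (forall x, D x -> x <= c -> D1 x) -> (forall x, D x -> c <= x -> D2 x) ->
  osc_on D1 X T B1 -> osc_on D2 X T B2 -> osc_on D X T (B1 + B2).
Proof.
move=> B10 B20 D1c D2c sub1 sub2 h1 h2 th Phi u v u0 uv Du Dv dPhi.
have [vc|cv] := leP v c.
  apply: (@le_trans _ _ B1); last lra.
  by apply: h1 dPhi => //; apply: sub1 => //; apply: le_trans vc.
have [cu|uc] := leP c u.
  apply: (@le_trans _ _ B2); last lra.
  by apply: h2 dPhi => //; apply: sub2 => //; apply: ltW.
have -> : Phi v - Phi u = (Phi c - Phi u) + (Phi v - Phi c) by ring.
apply: le_trans (ler_normD _ _) _; apply: lerD.
  apply: (h1 th) => //; [exact: ltW|by apply: sub1 => //; exact: ltW|].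
  by move=> x /andP[ux xc]; apply: dPhi; rewrite ux (le_trans xc) ?ltW.
apply: (h2 th) => //; [exact: lt_trans uc|exact: ltW| |].
  by apply: sub2 => //; exact: ltW.
by move=> x /andP[cx xv]; apply: dPhi; rewrite xv (le_trans _ cx) ?ltW.
Qed.

Lemma norm_powR_cos_le (x y : R) : `|x `^ (- q) * cos y| <= x `^ (- q).
Proof.
rewrite normrM (ger0_norm (powR_ge0 _ _)) -[leRHS]mulr1.
by rewrite ler_wpM2l ?powR_ge0// ler_norml cos_geN1 cos_le1.
Qed.

(** Cancellation is ignored: [x ^ (- q)] is integrable at 0 because [q < 1]. *)
Lemma osc_on_trivial b X T : 0 <= b ->
  osc_on (fun x => x <= b) X T (b `^ (1 - q) / (1 - q)).
Proof.
move: (hq) (hq1) (hm) => hq' hq1' hm'.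
move=> b0 th Phi u v u0 uv ub vb dPhi.
have q1 : 0 < 1 - q by lra.
pose V x := x `^ (1 - q) / (1 - q).
apply: (@le_trans _ _ (V v - V u)).
  apply: (@is_derive1_dist_le R Phi _ V (fun x => x `^ (- q)) u v uv dPhi).
    move=> x /andP[ux xv]; have x0 : 0 < x by apply: lt_le_trans ux.
    have h := is_derive1_mul (is_derive1_powR (1 - q) x0)
      (is_derive_cst (1 - q)^-1 x 1).
    apply: (is_derive_eq h); rewrite /cst /= (_ : 1 - q - 1 = - q); last by ring.
    by rewrite mulr0 addr0 mulrAC divff ?mul1r// gt_eqF.
  by move=> x _; exact: norm_powR_cos_le.
rewrite /V -mulrBl ler_pM2r ?invr_gt0//.
apply: (@le_trans _ _ (v `^ (1 - q))); first by rewrite gerBl powR_ge0.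
by apply: powR_le_base => //; rewrite ltW// (lt_le_trans u0).
Qed.

Lemma osc_on_segment a b X T : 0 < a ->
  osc_on (fun x => a <= x <= b) X T (a `^ (- q) * (b - a)).
Proof.
move: (hq) => hq'.
move=> a0 th Phi u v u0 uv /andP[au ub] /andP[av vb] dPhi.
pose V x := a `^ (- q) * x.
apply: (@le_trans _ _ (V v - V u)).
  apply: (@is_derive1_dist_le R Phi _ V (fun x => a `^ (- q)) u v uv dPhi).
    move=> x _.
    have h := is_derive1_mul (is_derive_cst (a `^ (- q)) x 1) (is_derive_id x 1).
    by apply: (is_derive_eq h); rewrite /cst /=; ring.
  move=> x /andP[ux xv]; apply: le_trans (norm_powR_cos_le _ _) _.
  by apply: powR_le_base_neg; [lra|done|exact: le_trans ux].
by rewrite /V -mulrBr ler_wpM2l ?powR_ge0//; lra.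
Qed.

(** [0 <= T] and [1 < m] make the phase convex, and the amplitude decreases from at most
    [a ^ (- q)]; van der Corput's lemma applies as soon as the phase derivative stays away from
    0. *)
Lemma osc_on_van_der_corput D a lam X T : 0 < a -> 0 < lam -> 0 <= T ->
  (forall x, D x -> a <= x) ->
  (forall u v x, D u -> D v -> u <= x <= v -> D x) ->
  (forall x, D x -> lam <= X + T * (m * x `^ (m - 1))) \/
  (forall x, D x -> X + T * (m * x `^ (m - 1)) <= - lam) ->
  osc_on D X T (4 * a `^ (- q) / lam).
Proof.
move: (hq) (hq1) (hm) => hq' hq1' hm'.
move=> a0 lam0 T0 Da convD hD th Phi u v u0 uv Du Dv dPhi.
have Dx x : u <= x <= v -> D x by apply: convD.
have x0 x : u <= x <= v -> 0 < x by move=> /andP[ux _]; apply: lt_le_trans ux.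
apply: (@le_trans _ _ (4 * u `^ (- q) / lam)); last first.
  rewrite ler_pM2r ?invr_gt0// ler_pM2l//.
  by apply: powR_le_base_neg; [lra|done|exact: Da].
apply: (@van_der_corput R (fun x => X * x + T * x `^ m + th)
  (fun x => X + T * (m * x `^ (m - 1)))
  (fun x => T * (m * ((m - 1) * x `^ (m - 1 - 1))))
  (fun x => x `^ (- q)) (fun x => - q * x `^ (- q - 1)) Phi lam u v) => //.
- move=> x hx.
  have h1 := is_derive1_mul (is_derive_cst X x 1) (is_derive_id x 1).
  have h2 := is_derive1_mul (is_derive_cst T x 1) (is_derive1_powR m (x0 x hx)).
  apply: (is_derive_eq (is_deriveD (is_deriveD h1 h2) (is_derive_cst th x 1))).
  by rewrite /cst /=; ring.
- move=> x hx.
  have h1 := is_derive1_mul (is_derive_cst m x 1)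
    (is_derive1_powR (m - 1) (x0 x hx)).
  have h2 := is_derive1_mul (is_derive_cst T x 1) h1.
  apply: (is_derive_eq (is_deriveD (is_derive_cst X x 1) h2)).
  by rewrite /cst /=; ring.
- by move=> x hx; exact: is_derive1_powR (x0 x hx).
- move=> x _; rewrite !mulr_ge0 ?powR_ge0//; lra.
- by move=> x _; exact: powR_ge0.
- by move=> x _; rewrite mulNr oppr_le0 mulr_ge0 ?powR_ge0//; lra.
- by case: hD => h; [left|right] => x /Dx /h.
Qed.

(** Cosine is even, so the whole phase may change sign along with [theta]; this reduces matters to
    [0 <= T]. *)
Lemma osc_bound_opp X T B : osc_bound X T B -> osc_bound (- X) (- T) B.
Proof.
move=> h th Phi u v u0 uv _ _ dPhi; apply: (h (- th)) => // x /dPhi hx.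
apply: (is_derive_eq hx); rewrite -[in RHS]cosN; congr (_ * cos _); ring.
Qed.

(** Substitution [y = c x]: the differential and the amplitude together produce the factor
    [c ^ (1 - q)] in [Psi]. It normalizes either [X] or [T] to modulus 1. *)
Lemma osc_bound_scale c X T B : 0 < c ->
  osc_bound X T B -> osc_bound (c * X) (c `^ m * T) (c `^ (q - 1) * B).
Proof.
move=> c0 h th Phi u v u0 uv _ _ dPhi.
pose Psi y := c `^ (1 - q) * Phi (y / c).
have : `|Psi (c * v) - Psi (c * u)| <= B.
  apply: (h th) => //; [exact: mulr_gt0|by rewrite ler_pM2l|].
  move=> y /andP[uy yv].
  have hyc : u <= y / c <= v by rewrite ler_pdivlMr// ler_pdivrMr// mulrC uy mulrC.
  have h1 := is_derive1_mul (is_derive_id y 1) (is_derive_cst c^-1 y 1).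
  have h2 := @is_derive1_comp R Phi (fun z => z / c) y _ _ (dPhi _ hyc) h1.
  have h3 := is_derive1_mul (is_derive_cst (c `^ (1 - q)) y 1) h2.
  apply: (is_derive_eq h3); rewrite /cst /=.
  have y0 : 0 < y by apply: lt_le_trans uy; exact: mulr_gt0.
  have -> : c * X * (y / c) + c `^ m * T * (y / c) `^ m + th =
    X * y + T * y `^ m + th.
    congr (_ + _ + _); first by field; rewrite gt_eqF.
    rewrite mulrAC -powRM; [|exact: ltW|by rewrite divr_ge0 ?ltW].
    by rewrite mulrC; congr (_ * _ `^ _); field; rewrite gt_eqF.
  have e : c `^ (1 - q) * ((y / c) `^ (- q) * c^-1) = y `^ (- q).
    rewrite powRD; last by rewrite (gt_eqF c0) implybT.
    rewrite powRr1; last exact: ltW.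
    have -> : c * c `^ (- q) * ((y / c) `^ (- q) * c^-1) =
        c `^ (- q) * (y / c) `^ (- q) by field; rewrite gt_eqF.
    rewrite -powRM; [|exact: ltW|by rewrite divr_ge0 ?ltW].
    by congr (_ `^ _); field; rewrite gt_eqF.
  by rewrite -{}e; ring.
have -> : Psi (c * v) - Psi (c * u) = c `^ (1 - q) * (Phi v - Phi u).
  by rewrite /Psi ![c * _ / c]mulrAC !divff ?mul1r ?gt_eqF// mulrBr.
rewrite normrM (ger0_norm (powR_ge0 _ _)) => h1.
have -> : q - 1 = - (1 - q) by ring.
by rewrite powRN mulrC ler_pdivlMr ?powR_gt0// mulrC.
Qed.

(** There is no stationary point, since the phase derivative is at least 1; only the singularity of
    the amplitude at 0 is treated apart. *)
Lemma osc_bound_unit_pos T : 0 <= T -> osc_bound 1 T ((1 - q)^-1 + 4).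
Proof.
move: (hq) (hq1) (hm) => hq' hq1' hm'.
move=> T0; have q1 : 0 < 1 - q by lra.
apply: (@osc_on_glue 1 _ (fun x => x <= 1) (fun x => 1 <= x)) => //.
- by rewrite invr_ge0 ltW.
- have := @osc_on_trivial 1 1 T ler01.
  by rewrite powR1 mul1r.
- have := @osc_on_van_der_corput (fun x => 1 <= x) 1 1 1 T ltr01 ltr01 T0.
  rewrite powR1 mulr1 divr1; apply => //.
    by move=> u v x u1 _ /andP[ux _]; apply: le_trans ux.
  left => x x1; rewrite lerDl !mulr_ge0 ?powR_ge0//; lra.
Qed.

(** [xi] is the stationary point of [- x + T x ^ m]. Up to 8 the trivial bound absorbs it; beyond 8
    one has [2 xi <= x], and the phase derivative [(x / xi) ^ (m - 1) - 1] is bounded below. *)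
Lemma osc_bound_unit_neg_low T xi : 0 < xi -> xi < 4 -> T * m = (xi `^ (m - 1))^-1 ->
  osc_bound (-1) T (8 `^ (1 - q) / (1 - q) + 4 * 8 `^ (- q) / (2 `^ (m - 1) - 1)).
Proof.
move: (hq) (hq1) (hm) => hq' hq1' hm'.
move=> xi0 xi4 Txi.
have T0 : 0 <= T.
  have : 0 < T * m by rewrite Txi invr_gt0 powR_gt0.
  by rewrite pmulr_lgt0; [exact: ltW|exact: lt_trans hm'].
have q1 : 0 < 1 - q by lra.
have lam0 : 0 < 2 `^ (m - 1) - 1 :> R.
  by rewrite subr_gt0 powR_gt1//; lra.
apply: (@osc_on_glue 8 _ (fun x => x <= 8) (fun x => 8 <= x)) => //.
- by rewrite divr_ge0 ?powR_ge0// ltW.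
- by rewrite divr_ge0 ?mulr_ge0 ?powR_ge0// ltW.
- exact: osc_on_trivial.
- apply: osc_on_van_der_corput => //.
    by move=> u v x u1 _ /andP[ux _]; apply: le_trans ux.
  left => x x8; have x0 : 0 < x by lra.
  rewrite mulrA Txi mulrC -powR_div ?(ltW x0)// [leRHS]addrC lerD2r.
  apply: powR_le_base => //; first lra.
  by rewrite ler_pdivlMr//; lra.
Qed.

(** The stationary point is [xi = d ^ 2], and the line is cut at [1], [xi / 2], [xi - d] and
    [xi + d], in this order because [2 <= d]. Around [xi] the amplitude is [O(1 / d)]: the window of
    length [2 d] contributes [O(1)], and on its two sides the phase derivative is at least of order
    [1 / d], which balances the amplitude. *)
Lemma osc_bound_unit_neg_high T d : 2 <= d ->
  T * m = ((d ^+ 2) `^ (m - 1))^-1 -> let c := Num.min 1 (m - 1) in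
  osc_bound (-1) T ((1 - q)^-1 + (4 / (1 - 2^-1 `^ (m - 1)) +
    (8 / c + (4 + 16 / c)))).
Proof.
move: (hq) (hq1) (hm) => hq' hq1' hm'.
move=> d2 Td c; set xi := d ^+ 2 in Td.
have d0 : 0 < d by lra.
have xi0 : 0 < xi by rewrite exprn_gt0.
have m0 : 0 < m - 1 by lra.
have c0 : 0 < c by rewrite lt_min ltr01.
have T0 : 0 <= T.
  have : 0 < T * m by rewrite Td invr_gt0 powR_gt0.
  by rewrite pmulr_lgt0; [exact: ltW|exact: lt_trans hm'].
have q1 : 0 < 1 - q by lra.
have d2xi : 2 * d <= xi by rewrite /xi expr2 ler_wpM2r// ltW.
have lam0 : 0 < 1 - 2^-1 `^ (m - 1) :> R.
  by rewrite subr_gt0 powR_lt1 ?invr_ge0// invf_lt1// ltr1n.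
have dphi x : 0 < x ->
    -1 + T * (m * x `^ (m - 1)) = (x / xi) `^ (m - 1) - 1.
  by move=> x0; rewrite mulrA Td mulrC addrC -powR_div ?(ltW x0).
(* Here [1 / 2 < q] enters: [(d / 2) ^ (- 2 q) <= (d / 2) ^ (- 1)], as [1 <= d / 2]. *)
have amp x : xi / 2 <= x -> x `^ (- q) <= 2 / d.
  move=> hx; apply: (@le_trans _ _ (((d / 2) ^+ 2) `^ (- q))).
    apply: powR_le_base_neg; [lra|by rewrite exprn_gt0 ?divr_gt0|].
    apply: le_trans hx; rewrite /xi; have := sqr_ge0 d; rewrite !expr2; lra.
  rewrite -powR_mulrn; last lra.
  rewrite -powRrM -[leRHS]invf_div -[leRHS]powR_inv1; last lra.
  apply: ler_powR; lra.
have c1 : c <= 1 by rewrite ge_min lexx.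
apply: (@osc_on_glue 1 _ (fun x => x <= 1) (fun x => 1 <= x)) => //.
- by rewrite invr_ge0 ltW.
- by rewrite !addr_ge0 ?divr_ge0 ?ltW.
- have := @osc_on_trivial 1 (-1) T ler01.
  by rewrite powR1 mul1r.
apply: (@osc_on_glue (xi / 2) _ (fun x => 1 <= x <= xi / 2)
  (fun x => xi / 2 <= x)) => //.
- by rewrite divr_ge0 ?ltW.
- by rewrite !addr_ge0 ?divr_ge0 ?ltW.
- by rewrite lexx andbT; lra.
- by move=> x -> ->.
- have := @osc_on_van_der_corput (fun x => 1 <= x <= xi / 2) 1
    (1 - 2^-1 `^ (m - 1)) (-1) T ltr01 lam0 T0.
  rewrite powR1 mulr1; apply.
  + by move=> x /andP[].
  + by move=> u v x /andP[? ?] /andP[? ?] /andP[? ?]; apply/andP; split; lra.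
  + right => x /andP[x1 x2]; have x0 : 0 < x by lra.
    rewrite dphi// opprB lerD2r; apply: powR_le_base; rewrite ?divr_ge0//; try lra.
    by rewrite ler_pdivrMr//; lra.
apply: (@osc_on_glue (xi - d) _ (fun x => xi / 2 <= x <= xi - d)
  (fun x => xi - d <= x)) => //.
- by rewrite divr_ge0 ?ltW.
- by rewrite !addr_ge0 ?divr_ge0 ?ltW.
- by rewrite lexx andbT; lra.
- by move=> x -> ->.
- apply: (@osc_on_le _ _ _ (4 * (xi / 2) `^ (- q) / (c / d))).
    have -> : 8 / c = 4 * (2 / d) / (c / d) by field; rewrite !gt_eqF.
    by rewrite ler_pM2r ?invr_gt0 ?divr_gt0// ler_pM2l// amp.
  apply: osc_on_van_der_corput => //; rewrite ?divr_gt0//.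
  + by move=> x /andP[].
  + by move=> u v x /andP[? ?] /andP[? ?] /andP[? ?]; apply/andP; split; lra.
  + right => x /andP[x1 x2]; have x0 : 0 < x by lra.
    have hx : 0 < x / xi <= 1.
      by rewrite divr_gt0// ler_pdivrMr// mul1r; lra.
    rewrite dphi//; have := powR_chord_le m0 hx; rewrite -/c.
    (* To the left of [xi - d] the relative distance to [xi = d ^ 2] is at least [1 / d]. *)
    have : c * (1 / d) <= c * (1 - x / xi).
      rewrite ler_pM2l// ler_pdivrMr// mulrBl mul1r.
      have -> : x / xi * d = x / d by rewrite /xi; field; rewrite gt_eqF.
      have : x / d <= (xi - d) / d by rewrite ler_pM2r ?invr_gt0.
      rewrite mulrBl divff ?gt_eqF// /xi expr2 mulfK ?gt_eqF//; lra.
    rewrite div1r; lra.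
apply: (@osc_on_glue (xi + d) _ (fun x => xi - d <= x <= xi + d)
  (fun x => xi + d <= x)) => //.
- by rewrite divr_ge0 ?ltW.
- by apply/andP; split; lra.
- by move=> x -> ->.
- apply: (@osc_on_le _ _ _ ((xi - d) `^ (- q) * (xi + d - (xi - d)))).
    have -> : 4 = 2 / d * (2 * d) :> R by field; rewrite gt_eqF.
    have -> : xi + d - (xi - d) = 2 * d by ring.
    by rewrite ler_pM2r ?mulr_gt0// amp//; lra.
  by apply: osc_on_segment; lra.
apply: (@osc_on_le _ _ _ (4 * (xi + d) `^ (- q) / (c / (2 * d)))).
  have -> : 16 / c = 4 * (2 / d) / (c / (2 * d)) by field; rewrite !gt_eqF.
  by rewrite ler_pM2r ?invr_gt0 ?divr_gt0 ?mulr_gt0// ler_pM2l// amp//; lra.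
apply: osc_on_van_der_corput => //; rewrite ?divr_gt0 ?mulr_gt0//; try lra.
  by move=> u v x u1 _ /andP[ux _]; apply: le_trans ux.
left => x hx; have x0 : 0 < x by lra.
rewrite dphi//.
apply: (@le_trans _ _ ((1 + d^-1) `^ (m - 1) - 1)); last first.
  rewrite lerD2r; apply: powR_le_base; [lra| |].
    by rewrite addr_ge0// invr_ge0 ltW.
  rewrite ler_pdivlMr// mulrDl mul1r.
  by rewrite {2}/xi expr2 mulKf ?gt_eqF.
set w := 1 + d^-1.
have id0 : 0 < d^-1 by rewrite invr_gt0.
have w1 : 1 <= w by rewrite lerDl ltW.
have w0 : 0 < w by lra.
have iw : 0 < w^-1 <= 1 by rewrite invr_gt0 w0 invf_le1.
have := powR_chord_le m0 iw; rewrite -/c => h.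
have wm : 1 <= w `^ (m - 1).
  have [->|] := eqVneq w 1; first by rewrite powR1.
  by move=> w1'; rewrite ltW// powR_gt1// lt_neqAle eq_sym w1'.
(* The chord bound concerns arguments at most 1, so the excess of [w ^ (m - 1)] over 1 is expressed
   through [w^-1]. *)
have e : w `^ (m - 1) * (1 - w^-1 `^ (m - 1)) = w `^ (m - 1) - 1.
  by rewrite mulrBr mulr1 -powRM ?invr_ge0 ?ltW// divff ?gt_eqF// powR1.
rewrite -e.
have h0 : 0 <= 1 - w^-1 by lra.
apply: le_trans (_ : c * (1 - w^-1) <= _); last first.
  apply: (le_trans h); rewrite ler_peMl//; apply: (le_trans _ h).
  by rewrite mulr_ge0// ltW.
rewrite ler_pM2l//.
have -> : 1 - w^-1 = (d + 1)^-1.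
  by rewrite /w; field; rewrite !gt_eqF//; lra.
by rewrite lef_pV2 ?posrE; lra.
Qed.

Lemma osc_bound_unit : exists2 C, 0 < C &
  forall X T, `|X| = 1 -> osc_bound X T C.
Proof.
move: (hq) (hq1) (hm) => hq' hq1' hm'.
have q1 : 0 < 1 - q by lra.
have m0 : 0 < m - 1 by lra.
pose c := Num.min 1 (m - 1).
have c0 : 0 < c by rewrite lt_min ltr01.
have lam0 : 0 < 1 - 2^-1 `^ (m - 1) :> R.
  by rewrite subr_gt0 powR_lt1 ?invr_ge0// invf_lt1// ltr1n.
have lam1 : 0 < 2 `^ (m - 1) - 1 :> R.
  by rewrite subr_gt0 powR_gt1//; lra.
pose B1 := (1 - q)^-1 + 4.
pose B2 := 8 `^ (1 - q) / (1 - q) + 4 * 8 `^ (- q) / (2 `^ (m - 1) - 1).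
pose B3 := (1 - q)^-1 + (4 / (1 - 2^-1 `^ (m - 1)) + (8 / c + (4 + 16 / c))).
have B10 : 0 < B1 by rewrite addr_gt0 ?invr_gt0.
have B20 : 0 < B2 by rewrite addr_gt0 ?divr_gt0 ?mulr_gt0 ?powR_gt0.
have B30 : 0 < B3 by rewrite !addr_gt0 ?divr_gt0 ?invr_gt0.
pose C := B1 + B2 + B3.
exists C; first by rewrite /C; lra.
have main T : 0 <= T -> osc_bound 1 T C /\ osc_bound (-1) T C.
  move=> T0; split.
    by apply: osc_on_le (osc_bound_unit_pos T0); rewrite -/B1 /C; lra.
  have [T1|T1] := eqVneq T 0.
    apply: (@osc_on_le _ _ _ B1); first by rewrite /C; lra.
    rewrite T1 -[0]oppr0; apply: osc_bound_opp; exact: osc_bound_unit_pos.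
  have Tm0 : 0 < T * m by rewrite mulr_gt0 ?lt_neqAle ?T0 1?eq_sym ?T1//; lra.
  (* The root of the phase derivative [- 1 + T m x ^ (m - 1)]; it exists because the case [T = 0] is
     already settled. *)
  pose xi := (T * m) `^ (- (m - 1)^-1).
  have xi0 : 0 < xi by exact: powR_gt0.
  have Txi : T * m = (xi `^ (m - 1))^-1.
    rewrite /xi -powRrM mulNr mulVf ?gt_eqF// powR_inv1 ?invrK//; exact: ltW.
  have [xi4|xi4] := ltP xi 4.
    apply: osc_on_le (osc_bound_unit_neg_low xi0 xi4 Txi).
    by rewrite -/B2 /C; lra.
  have d2 : 2 <= Num.sqrt xi.
    have -> : 2 = Num.sqrt 4 :> R.
      by rewrite (_ : 4 = 2 ^+ 2) ?sqrtr_sqr ?ger0_norm// expr2; ring.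
    by rewrite ler_sqrt// ltW.
  apply: osc_on_le (osc_bound_unit_neg_high d2 _); first by rewrite -/B3 /C; lra.
  by rewrite sqr_sqrtr// ltW.
move=> X T; have [T0|/ltW T0] := leP 0 T.
  have [h1 h2] := main T T0.
  by have [X0|X0] := leP 0 X; [rewrite ger0_norm|rewrite ltr0_norm]=> // e;
    [rewrite e|rewrite -[X]opprK e].
have [|h1 h2] := main (- T); first by rewrite oppr_ge0.
have [X0|X0] := leP 0 X; [rewrite ger0_norm|rewrite ltr0_norm]=> // e.
  by rewrite e -[1]opprK -[T]opprK; exact: osc_bound_opp.
by rewrite -[X]opprK e -[T]opprK; exact: osc_bound_opp.
Qed.

(** Dilation by [|X|] reduces to [|X| = 1], where the bound is uniform in [T]. *)
Lemma osc_bound_space : exists2 C, 0 < C &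
  forall X T, X != 0 -> osc_bound X T (C * `|X| `^ (q - 1)).
Proof.
have [C C0 hC] := osc_bound_unit; exists C => // X T X0.
have aX0 : 0 < `|X| by rewrite normr_gt0.
have h1 : `|X / `|X| | = 1.
  by rewrite normrM normfV normr_id divff// gt_eqF.
have := osc_bound_scale aX0 (hC _ (T / `|X| `^ m) h1).
rewrite mulrCA divff ?gt_eqF// mulr1 mulrCA divff ?mulr1; last first.
  by rewrite gt_eqF// powR_gt0.
by rewrite mulrC.
Qed.

(** Dilation by [|T| ^ (1 / m)] reduces to [T = 1]. If [m / 2 <= |X|] the bound in [X] suffices;
    otherwise [X + m x ^ (m - 1)] is at least [m / 2] for [1 <= x]. *)
Lemma osc_bound_time : exists2 C, 0 < C &
  forall X T, T != 0 -> osc_bound X T (C * `|T| `^ ((q - 1) / m)).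
Proof.
move: (hq) (hq1) (hm) => hq' hq1' hm'.
have m0 : 0 < m by lra.
have q1 : 0 < 1 - q by lra.
have [C C0 hC] := osc_bound_space.
pose C1 := C * (m / 2) `^ (q - 1).
pose C2 := (1 - q)^-1 + 4 / (m / 2).
have C10 : 0 < C1 by rewrite mulr_gt0// powR_gt0// divr_gt0.
have C20 : 0 < C2 by rewrite addr_gt0 ?invr_gt0 ?divr_gt0.
exists (C1 + C2); first exact: addr_gt0.
have unit X : osc_bound X 1 (C1 + C2).
  have [hX|hX] := leP (m / 2) `|X|.
    have aX : 0 < `|X| by lra.
    apply: (@osc_on_le _ _ _ (C * `|X| `^ (q - 1))); last first.
      by apply: hC; rewrite -normr_gt0.
    suff : C * `|X| `^ (q - 1) <= C1 by lra.
    rewrite ler_pM2l//; apply: powR_le_base_neg => //; lra.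
  apply: (@osc_on_le _ _ _ C2); first lra.
  apply: (@osc_on_glue 1 _ (fun x => x <= 1) (fun x => 1 <= x)) => //.
  - by rewrite invr_ge0 ltW.
  - by rewrite divr_ge0//; lra.
  - have := @osc_on_trivial 1 X 1 ler01.
    by rewrite powR1 mul1r.
  - have m2 : 0 < m / 2 by lra.
    have := @osc_on_van_der_corput (fun x => 1 <= x) 1 (m / 2) X 1 ltr01 m2 ler01.
    rewrite powR1 mulr1; apply => //.
      by move=> u v x u1 _ /andP[ux _]; apply: le_trans ux.
    left => x x1; rewrite mul1r.
    have x1' : 1 <= x `^ (m - 1).
      have [->|x1'] := eqVneq x 1; first by rewrite powR1.
      by rewrite ltW// powR_gt1//; [lra|rewrite lt_neqAle eq_sym x1'].
    have : m * 1 <= m * x `^ (m - 1) by rewrite ler_pM2l.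
    move: hX; rewrite ltr_norml => /andP[]; lra.
move=> X T T0.
have aT0 : 0 < `|T| by rewrite normr_gt0.
pose c := `|T| `^ m^-1.
have c0 : 0 < c by exact: powR_gt0.
have cm : c `^ m = `|T| by rewrite /c -powRrM mulVf ?gt_eqF// powRr1 ?ltW.
have cq : c `^ (q - 1) = `|T| `^ ((q - 1) / m) by rewrite /c -powRrM mulrC.
have scale Y : osc_bound Y `|T| ((C1 + C2) * `|T| `^ ((q - 1) / m)).
  have := osc_bound_scale c0 (unit (Y / c)).
  by rewrite mulrCA divff ?gt_eqF// mulr1 mulr1 cm cq mulrC.
have [T1|T1] := leP 0 T.
  by have := scale X; rewrite (ger0_norm T1).
have := scale (- X); rewrite (ltr0_norm T1) => /osc_bound_opp.
by rewrite !opprK.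
Qed.

End OscillatoryKernel.

(** The amplitude alone has mass [(q - 1)^-1] on [[1, +oo[]. This serves the range [1 / 2 < s]. *)
Lemma osc_on_ge1 (R : realType) (q m X T : R) : 1 < q ->
  osc_on q m (fun x => 1 <= x) X T (q - 1)^-1.
Proof.
move=> q1 th Phi u v u0 uv u1 v1 dPhi.
pose V x := - (x `^ (1 - q) / (q - 1)).
apply: (@le_trans _ _ (V v - V u)).
  apply: (@is_derive1_dist_le R Phi _ V (fun x => x `^ (- q)) u v uv dPhi).
    move=> x /andP[ux xv]; have x0 : 0 < x by apply: lt_le_trans ux.
    have h := is_derive1_mul (is_derive1_powR (1 - q) x0)
      (is_derive_cst (q - 1)^-1 x 1).
    apply: (is_derive_eq (is_deriveN h)).
    rewrite /cst /= (_ : 1 - q - 1 = - q); last by ring.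
    rewrite mulr0 addr0 mulrAC -mulNr -mulNr opprB divff ?mul1r// gt_eqF//.
    by rewrite subr_gt0.
  by move=> x _; apply: norm_powR_cos_le.
rewrite /V opprK addrC -mulrBl -[leRHS]mul1r ler_pM2r ?invr_gt0 ?subr_gt0//.
apply: (@le_trans _ _ (u `^ (1 - q))); first by rewrite gerBl powR_ge0.
have [->|un1] := eqVneq u 1; first by rewrite powR1.
rewrite -opprB powRN invf_le1 ?powR_gt0// ltW// powR_gt1 ?subr_gt0//.
by rewrite lt_neqAle eq_sym un1.
Qed.

(** * Kernel integrals over annuli *)

Section KernelIntegral.
Variable R : realType.
Implicit Types (q m X T M N B th x : R).
Local Notation leb := (@lebesgue_measure R).

Definition phase m X T th x : R := X * x + T * (`|x| `^ m) + th.

Definition annulus M N : set R := [set x | M < `|x| <= N].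

Lemma annulusE M N : 0 <= M -> M <= N ->
  annulus M N = `]M, N] `|` `[- N, - M[.
Proof.
move=> M0 MN; apply/seteqP; split => x /=; rewrite /annulus /= !in_itv /=.
  case: (leP 0 x) => x0.
    by rewrite ger0_norm// => ->; left.
  rewrite ltr0_norm// => /andP[h1 h2]; right; apply/andP; split; lra.
case=> /andP[h1 h2].
  by rewrite ger0_norm ?h1 ?h2//; lra.
by rewrite ler0_norm; [apply/andP; split; lra|lra].
Qed.

Lemma measurable_annulus M N : measurable (annulus M N).
Proof.
have -> : annulus M N = (fun x : R => `|x|) @^-1` `]M, N].
  by apply/seteqP; split => x /=; rewrite in_itv.
rewrite -[X in measurable X]setTI.
by apply: normr_measurable => //; exact: measurable_itv.
Qed.

Lemma annulus_lty M N : (leb (annulus M N) < +oo)%E.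
Proof.
apply: (@le_lt_trans _ _ (leb `[- N, N])).
  apply: le_measure; rewrite ?inE//; first exact: measurable_annulus.
  by move=> x /= /andP[_]; rewrite in_itv /= ler_norml.
rewrite lebesgue_measure_itv /=; case: ifPn => // _.
by rewrite -EFinB ltry.
Qed.

Lemma measurable_phase m X T th : measurable_fun setT (phase m X T th).
Proof.
apply: measurable_funD => //; apply: measurable_funD.
  exact: mulrl_measurable.
apply: measurable_funM => //.
apply: (measurableT_comp (measurable_powR m)); exact: normr_measurable.
Qed.

Lemma measurable_cos_phase m X T th :
  measurable_fun setT (fun x => cos (phase m X T th x)).
Proof.
apply: measurableT_comp; last exact: measurable_phase.
apply: continuous_measurable_fun; exact: continuous_cos.
Qed.

Lemma measurable_sin_phase m X T th :
  measurable_fun setT (fun x => sin (phase m X T th x)).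
Proof.
apply: measurableT_comp; last exact: measurable_phase.
apply: continuous_measurable_fun; exact: continuous_sin.
Qed.

Lemma measurable_normr_powR q : measurable_fun setT (fun x : R => `|x| `^ q).
Proof.
apply: (measurableT_comp (measurable_powR q)); exact: normr_measurable.
Qed.

Lemma integrable_annulus M N C (f : R -> R) : measurable_fun setT f ->
  (forall x, annulus M N x -> `|f x| <= C) ->
  leb.-integrable (annulus M N) (EFin \o f).
Proof.
move=> mf fC; apply: measurable_bounded_integrable.
- exact: measurable_annulus.
- exact: annulus_lty.
- exact: measurable_funTS.
- exists C; split; first exact: num_real.
  by move=> y Cy x hx /=; apply: le_trans (ltW Cy); exact: fC.
Qed.

Definition power_cos q m X T th x : R := x `^ (- q) * cos (X * x + T * x `^ m + th).

Definition dpower_cos q m X T th x : R :=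
  - q * x `^ (- q - 1) * cos (X * x + T * x `^ m + th) -
  x `^ (- q) * (sin (X * x + T * x `^ m + th) * (X + T * (m * x `^ (m - 1)))).

Lemma is_derive_power_cos q m X T th x : 0 < x ->
  is_derive x 1 (power_cos q m X T th) (dpower_cos q m X T th x).
Proof.
move=> x0.
have h1 := is_derive1_mul (is_derive_cst X x 1) (is_derive_id x 1).
have h2 := is_derive1_mul (is_derive_cst T x 1) (is_derive1_powR m x0).
have h3 := is_deriveD (is_deriveD h1 h2) (is_derive_cst th x 1).
have h4 := @is_derive1_comp R cos (fun y => X * y + T * y `^ m + th) x _ _
  (is_derive_cos _) h3.
apply: (is_derive_eq (is_derive1_mul (is_derive1_powR (- q) x0) h4)).
by rewrite /dpower_cos /cst /=; ring.
Qed.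

Lemma continuous_power_cos q m X T th a b : 0 < a ->
  {within `[a, b], continuous (power_cos q m X T th)}.
Proof.
move=> a0; apply: (@is_derive1_within_continuous R _ (dpower_cos q m X T th)).
by move=> x /andP[ax _]; apply: is_derive_power_cos; apply: lt_le_trans ax.
Qed.

Lemma integrable_power_cos q m X T th a b : 0 < a ->
  leb.-integrable `[a, b] (EFin \o power_cos q m X T th).
Proof.
move=> a0; apply: continuous_compact_integrable.
  exact: segment_compact.
exact: continuous_power_cos.
Qed.

(** The fundamental theorem of calculus turns the integral into an increment of an antiderivative,
    as [osc_on] requires. *)
Lemma power_cos_bound q m X T th (D : R -> Prop) B M N :
  0 < M -> M <= N -> D M -> D N ->
  osc_on q m D X T B ->
  `|\int[leb]_(x in `]M, N]) power_cos q m X T th x| <= B.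
Proof.
move=> M0 MN DM DN osc.
(* Starting the primitive strictly to the left of [M] makes it differentiable at [M] itself; [x + 1]
   does the same on the right. *)
pose a := M / 2.
have a0 : 0 < a by rewrite divr_gt0.
have aM : a < M by rewrite /a; lra.
pose Phi x := \int[leb]_(y in `[a, x]) power_cos q m X T th y.
have -> : \int[leb]_(x in `]M, N]) power_cos q m X T th x = Phi N - Phi M.
  rewrite /Phi Rintegral_itvB//; first exact: integrable_power_cos.
  by rewrite bnd_simp ltW.
apply: (osc th) => // x /andP[Mx xN].
have ax : a < x by apply: lt_le_trans Mx.
have x0 : 0 < x by apply: lt_trans ax.
have cx : {for x, continuous (power_cos q m X T th)}.
  apply: differentiable_continuous; apply/derivable1_diffP.
  by have [] := is_derive_power_cos q m X T th x0.
have xx1 : x < x + 1 by rewrite ltrDl.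
have [d1 d2] := continuous_FTC1_closed xx1
  (@integrable_power_cos q m X T th a (x + 1) a0) ax cx.
by apply: DeriveDef; [exact: d1|rewrite -derive1E; exact: d2].
Qed.

(** The reflection [x -> - x] carries the negative half of the annulus to the positive one and
    replaces [X] by [- X]; hence two oscillation hypotheses and the bound [B + B]. *)
Lemma kernel_bound q m X T th (D : R -> Prop) B M N :
  0 < q -> 0 < M -> M <= N -> D M -> D N ->
  osc_on q m D X T B -> osc_on q m D (- X) T B ->
  `|\int[leb]_(x in annulus M N) (`|x| `^ (- q) * cos (phase m X T th x))|
    <= B + B.
Proof.
move=> q0 M0 MN DM DN osc1 osc2.
pose f x := `|x| `^ (- q) * cos (phase m X T th x).
have Ef1 x : 0 <= x -> f x = power_cos q m X T th x.
  by move=> x0; rewrite /f /phase /power_cos ger0_norm.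
have Ef2 x : 0 <= x -> f (- x) = power_cos q m (- X) T th x.
  by move=> x0; rewrite /f /phase /power_cos normrN ger0_norm// mulrN mulNr.
have Ef3 x : x <= 0 -> f x = power_cos q m (- X) T th (- x).
  by move=> x0; rewrite -Ef2 ?opprK// oppr_ge0.
have cont : {within `[- N, - M], continuous f}.
  apply: (@subspace_eq_continuous _ _ _ (fun x => power_cos q m (- X) T th (- x))).
    move=> x; rewrite inE /= in_itv /= => /andP[_ h].
    by rewrite /from_subspace Ef3//; lra.
  apply: (@is_derive1_within_continuous R _
     (fun x => dpower_cos q m (- X) T th (- x) * -1)) => x /andP[h1 h2].
  have x0 : 0 < - x by lra.
  exact: (@is_derive1_comp R (power_cos q m (- X) T th) (fun x => - x) x _ _
    (is_derive_power_cos q m (- X) T th x0) (is_deriveN (is_derive_id x 1))).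
have int2 : leb.-integrable `[- N, - M] (EFin \o f).
  by apply: continuous_compact_integrable => //; exact: segment_compact.
have int1 : leb.-integrable `[M, N] (EFin \o f).
  have := @integrable_power_cos q m X T th M N M0; apply: eq_integrable => //.
  move=> x; rewrite inE /= in_itv /= => /andP[h _].
  by rewrite Ef1//; lra.
rewrite annulusE ?(ltW M0)// Rintegral_setU//=; first last.
- apply/disj_setPS => x [/=]; rewrite !in_itv /= => /andP[? ?] /andP[? ?]; lra.
- rewrite -annulusE ?(ltW M0)//; apply: (@integrable_annulus _ _ (M `^ (- q))).
    by apply: measurable_funM; [exact: measurable_normr_powR|
                                exact: measurable_cos_phase].
  move=> x /andP[Mx _]; apply: (le_trans (norm_powR_cos_le _ _ _)).
  by apply: powR_le_base_neg; [rewrite oppr_le0 ltW|done|exact: ltW].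
apply: (le_trans (ler_normD _ _)); apply: lerD.
  have -> : \int[leb]_(x in `]M, N]) f x =
      \int[leb]_(x in `]M, N]) power_cos q m X T th x.
    apply: eq_Rintegral => x; rewrite inE /= in_itv /= => /andP[h _].
    by apply: Ef1; lra.
  exact: power_cos_bound osc1.
rewrite Rintegral_itv_bndo_bndc; last first.
  by apply: integrableS int2 => //; apply: subset_itvl; rewrite bnd_simp.
rewrite /Rintegral (@integration_by_substitution_oppr R f)//.
have -> : (\int[leb]_(x in `[M, N]) ((f \o -%R) x)%:E)%E =
    (\int[leb]_(x in `[M, N]) (power_cos q m (- X) T th x)%:E)%E.
  apply: eq_integral => x; rewrite inE /= in_itv /= => /andP[h _].
  by rewrite Ef2//; lra.
rewrite -/(Rintegral leb `[M, N] (power_cos q m (- X) T th)).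
rewrite -Rintegral_itv_obnd_cbnd; last first.
  have := @integrable_power_cos q m (- X) T th M N M0; apply: integrableS => //.
  by apply: subset_itvr; rewrite bnd_simp.
exact: power_cos_bound osc2.
Qed.

End KernelIntegral.

(** * Duality *)

Section Duality.
Context d (U : measurableType d) (R : realType).
Variable mu : {measure set U -> \bar R}.

Lemma integrable_EFin_sum (D : set U) (I : Type) (s : seq I) (f : I -> U -> R) :
  measurable D -> (forall i, mu.-integrable D (EFin \o f i)) ->
  mu.-integrable D (EFin \o (fun x => \sum_(i <- s) f i x)).
Proof.
move=> mD hf.
have := @integrable_sum _ _ _ mu D mD I s predT (fun i => EFin \o f i)
  (fun i _ => hf i).
by apply: eq_integrable => // x _; rewrite /= sumEFin.
Qed.

Lemma Rintegral_sum (D : set U) (I : Type) (s : seq I) (f : I -> U -> R) :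
  measurable D -> (forall i, mu.-integrable D (EFin \o f i)) ->
  \int[mu]_(x in D) (\sum_(i <- s) f i x) =
  \sum_(i <- s) \int[mu]_(x in D) f i x.
Proof.
move=> mD hf; elim: s => [|i s ih].
  rewrite big_nil (@eq_Rintegral _ _ _ _ _ (cst 0)).
    by rewrite Rintegral_cst// mul0r.
  by move=> x _; rewrite big_nil.
rewrite big_cons -ih -RintegralD//; last exact: integrable_EFin_sum.
by apply: eq_Rintegral => x _; rewrite big_cons.
Qed.

(* With [A = sum p_i a_i], [B = sum p_i b_i],
   weighted AM-GM gives
   [A g1 - B g2 <= tau w (g1^2 + g2^2) / 2 + (A^2 + B^2) / (2 tau w)]. *)
Lemma dual_bound (D : set U) (I : finType) (p : I -> R) (a b : I -> U -> R)
    (g1 g2 w : U -> R) (tau : R) :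
  measurable D -> 0 < tau -> (forall x, D x -> 0 < w x) ->
  (forall i, mu.-integrable D (EFin \o (fun x => a i x * g1 x - b i x * g2 x))) ->
  mu.-integrable D (EFin \o (fun x => w x * (g1 x ^+ 2 + g2 x ^+ 2))) ->
  (forall i j, mu.-integrable D
     (EFin \o (fun x => (w x)^-1 * (a i x * a j x + b i x * b j x)))) ->
  \sum_i p i * \int[mu]_(x in D) (a i x * g1 x - b i x * g2 x) <=
  tau / 2 * \int[mu]_(x in D) (w x * (g1 x ^+ 2 + g2 x ^+ 2)) +
  (2 * tau)^-1 * \sum_i \sum_j p i * p j *
    \int[mu]_(x in D) ((w x)^-1 * (a i x * a j x + b i x * b j x)).
Proof.
move=> mD tau0 w0 hab hw hk.
have hZ (f : U -> R) (c : R) : mu.-integrable D (EFin \o f) ->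
    mu.-integrable D (EFin \o (fun x => c * f x)).
  by move=> hf; have := @integrableZl _ _ _ mu D mD c (EFin \o f) hf.
have -> : \sum_i p i * \int[mu]_(x in D) (a i x * g1 x - b i x * g2 x) =
    \int[mu]_(x in D) (\sum_i p i * (a i x * g1 x - b i x * g2 x)).
  rewrite Rintegral_sum//; last by move=> i; exact: hZ.
  by apply: eq_bigr => i _; rewrite RintegralZl.
pose K i j x := (w x)^-1 * (a i x * a j x + b i x * b j x).
have -> : \sum_i \sum_j p i * p j * \int[mu]_(x in D) K i j x =
    \int[mu]_(x in D) (\sum_i \sum_j p i * p j * K i j x).
  rewrite Rintegral_sum//.
    apply: eq_bigr => i _; rewrite Rintegral_sum//.
      by apply: eq_bigr => j _; rewrite RintegralZl//; exact: hk.
    by move=> j; apply: hZ; exact: hk.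
  by move=> i; apply: integrable_EFin_sum => // j; apply: hZ; exact: hk.
have hKs : mu.-integrable D
    (EFin \o (fun x => \sum_i \sum_j p i * p j * K i j x)).
  apply: integrable_EFin_sum => // i; apply: integrable_EFin_sum => // j.
  by apply: hZ; exact: hk.
rewrite -RintegralZl// -RintegralZl// -RintegralD//; [|exact: hZ|exact: hZ].
apply: le_Rintegral => //.
- by apply: integrable_EFin_sum => // i; exact: hZ.
- have := @integrableD _ _ _ mu D mD _ _ (hZ _ (tau / 2) hw)
    (hZ _ (2 * tau)^-1 hKs).
  by apply: eq_integrable.
move=> x Dx; have wx := w0 x Dx.
pose A := \sum_i p i * a i x; pose B := \sum_i p i * b i x.
have -> : \sum_i p i * (a i x * g1 x - b i x * g2 x) = A * g1 x - B * g2 x.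
  rewrite /A /B !mulr_suml -sumrB; apply: eq_bigr => i _; ring.
have -> : \sum_i \sum_j p i * p j * K i j x = (w x)^-1 * (A ^+ 2 + B ^+ 2).
  rewrite /A /B !expr2 !mulr_suml -big_split /= mulr_sumr.
  apply: eq_bigr => i _; rewrite !mulr_sumr -big_split /= mulr_sumr.
  by apply: eq_bigr => j _; rewrite /K; ring.
have c0 : 0 < tau * w x by exact: mulr_gt0.
(* The two sides differ exactly by the sum of these completed squares. *)
have h1 : 0 <= (2 * (tau * w x))^-1 * (tau * w x * g1 x - A) ^+ 2.
  by rewrite mulr_ge0 ?sqr_ge0// invr_ge0 mulr_ge0// ltW.
have h2 : 0 <= (2 * (tau * w x))^-1 * (tau * w x * g2 x + B) ^+ 2.
  by rewrite mulr_ge0 ?sqr_ge0// invr_ge0 mulr_ge0// ltW.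
rewrite -subr_ge0.
apply: le_trans (addr_ge0 h1 h2) _; rewrite le_eqVlt; apply/orP; left.
by apply/eqP; field; rewrite !gt_eqF.
Qed.

End Duality.

(** * Duality for truncated wave integrals *)

Section WaveIntegral.
Variables (R : realType) (m q : R) (g1 g2 : R -> R).
Hypothesis q0 : 0 < q.
Local Notation leb := (@lebesgue_measure R).
Hypotheses
  (ig1 : forall N, leb.-integrable `[- N, N] (EFin \o g1))
  (ig2 : forall N, leb.-integrable `[- N, N] (EFin \o g2)).

(** The real part of [e^{i phase} (g1 + i g2)]. Varying [th] rotates the complex value: [- pi / 2]
    gives the imaginary part and [pi] the opposite. *)
Definition wave (X T th x : R) : R :=
  cos (phase m X T th x) * g1 x - sin (phase m X T th x) * g2 x.

Definition energy_density (x : R) : R := `|x| `^ q * (g1 x ^+ 2 + g2 x ^+ 2).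

Definition kernel (X T th M N : R) : R :=
  \int[leb]_(x in annulus M N) (`|x| `^ (- q) * cos (phase m X T th x)).

Lemma integrable_bounded_mul (D : set R) (f g : R -> R) :
  measurable D -> leb.-integrable D (EFin \o g) -> measurable_fun setT f ->
  (forall x, `|f x| <= 1) -> leb.-integrable D (EFin \o (fun x => f x * g x)).
Proof.
move=> mD ig mf f1.
apply: (@integrableMr _ _ _ leb D mD f (EFin \o g)) => //.
  exact: measurable_funTS.
exists 1; split; first exact: num_real.
by move=> y y1 x _ /=; apply: le_trans (ltW y1); exact: f1.
Qed.

Lemma integrable_wave (D : set R) X T th : measurable D ->
  leb.-integrable D (EFin \o g1) -> leb.-integrable D (EFin \o g2) ->
  leb.-integrable D (EFin \o wave X T th).
Proof.
move=> mD i1 i2.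
have h1 : leb.-integrable D (EFin \o (fun x => cos (phase m X T th x) * g1 x)).
  apply: integrable_bounded_mul => //; first exact: measurable_cos_phase.
  by move=> x; rewrite ler_norml cos_geN1 cos_le1.
have h2 : leb.-integrable D (EFin \o (fun x => sin (phase m X T th x) * g2 x)).
  apply: integrable_bounded_mul => //; first exact: measurable_sin_phase.
  by move=> x; rewrite ler_norml sin_geN1 sin_le1.
have := @integrableB _ _ _ leb D mD _ _ h1 h2.
by apply: eq_integrable.
Qed.

Lemma annulus_sub_itv M N : annulus M N `<=` (`[- N, N] : set R).
Proof. by move=> x /andP[_]; rewrite /= in_itv /= ler_norml. Qed.

Lemma integrable_annulus_sub M N (f : R -> R) :
  leb.-integrable `[- N, N] (EFin \o f) ->
  leb.-integrable (annulus M N) (EFin \o f).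
Proof.
apply: integrableS => //; first exact: measurable_annulus.
exact: annulus_sub_itv.
Qed.

(** Duality works on one domain while the cutoffs vary, so each cutoff is moved into the
    integrand. *)
Lemma Rintegral_annulus_restrict M N n (f : R -> R) : N <= n ->
  \int[leb]_(x in annulus M N) f x =
  \int[leb]_(x in annulus M n) ((`|x| <= N)%R%:R * f x).
Proof.
move=> Nn.
have -> : annulus M N = [set x | `|x| <= N] `&` annulus M n.
  apply/seteqP; split => x; rewrite /annulus /=.
    by move=> /andP[-> h]; rewrite h (le_trans h Nn).
  by move=> [-> /andP[-> _]].
rewrite Rintegral_mkcondl; apply: eq_Rintegral => x _.
rewrite /patch; case: ifPn; first by rewrite inE /= => ->; rewrite mul1r.
by rewrite notin_setE /= => /negP/negbTE ->; rewrite mul0r.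
Qed.

(** Duality with weight [|x| ^ q]: the cosines and sines of two phases combine into the cosine of
    their difference, and the two cutoffs into their minimum. *)
Lemma wave_dual_bound (I : finType) (p X T th N : I -> R) (M n tau E : R) :
  1 <= M -> 0 < tau -> (forall i, N i <= n) ->
  leb.-integrable (annulus M n) (EFin \o energy_density) ->
  \int[leb]_(x in annulus M n) energy_density x <= E ->
  \sum_i p i * \int[leb]_(x in annulus M (N i)) wave (X i) (T i) (th i) x <=
  tau / 2 * E + (2 * tau)^-1 * \sum_i \sum_j p i * p j *
    kernel (X i - X j) (T i - T j) (th i - th j) M (Num.min (N i) (N j)).
Proof.
move=> M1 tau0 Nn iE hE.
have M0 : 0 < M by lra.
pose chi i (x : R) : R := (`|x| <= N i)%R%:R.
have mchi i : measurable_fun setT (chi i).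
  have -> : chi i = \1_(`[- N i, N i]%classic : set R).
    apply/funext => x; rewrite /chi indicE; congr (_%:R).
    by congr nat_of_bool; apply/idP/idP; rewrite inE /= in_itv /= ler_norml.
  by apply: measurable_indic; exact: measurable_itv.
have chi1 i x : `|chi i x| <= 1.
  by rewrite /chi; case: (`|x| <= _); rewrite ?normr1 ?normr0.
pose a i x := chi i x * cos (phase m (X i) (T i) (th i) x).
pose b i x := chi i x * sin (phase m (X i) (T i) (th i) x).
have abE i j x : a i x * a j x + b i x * b j x =
    (`|x| <= Num.min (N i) (N j))%R%:R *
    cos (phase m (X i - X j) (T i - T j) (th i - th j) x).
  have -> : phase m (X i - X j) (T i - T j) (th i - th j) x =
      phase m (X i) (T i) (th i) x - phase m (X j) (T j) (th j) x.
    by rewrite /phase; ring.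
  rewrite cosB /a /b /chi le_min.
  by case: (`|x| <= N i); case: (`|x| <= N j); rewrite /=; ring.
have -> : \sum_i p i * \int[leb]_(x in annulus M (N i)) wave (X i) (T i) (th i) x
   = \sum_i p i * \int[leb]_(x in annulus M n) (a i x * g1 x - b i x * g2 x).
  apply: eq_bigr => i _; rewrite (Rintegral_annulus_restrict _ _ (Nn i)).
  by congr (_ * _); apply: eq_Rintegral => x _; rewrite /wave /a /b /chi; ring.
have -> : \sum_i \sum_j p i * p j *
    kernel (X i - X j) (T i - T j) (th i - th j) M (Num.min (N i) (N j)) =
  \sum_i \sum_j p i * p j * \int[leb]_(x in annulus M n)
    ((`|x| `^ q)^-1 * (a i x * a j x + b i x * b j x)).
  apply: eq_bigr => i _; apply: eq_bigr => j _; congr (_ * _).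
  rewrite /kernel (@Rintegral_annulus_restrict _ _ n); last first.
    by rewrite ge_min Nn.
  by apply: eq_Rintegral => x _; rewrite abE powRN; ring.
apply: le_trans (_ : tau / 2 * \int[leb]_(x in annulus M n) energy_density x + _ <= _).
  apply: dual_bound => //.
  - exact: measurable_annulus.
  - by move=> x /andP[Mx _]; apply: powR_gt0; apply: lt_trans Mx.
  - move=> i.
    have mA := @measurable_annulus R M n.
    have h := @integrable_wave _ (X i) (T i) (th i) mA
      (integrable_annulus_sub M (ig1 n)) (integrable_annulus_sub M (ig2 n)).
    have := integrable_bounded_mul mA h (mchi i) (chi1 i).
    apply: eq_integrable => // x _ /=; congr (_%:E).
    by rewrite /a /b /wave; ring.
  move=> i j.
  apply: (@integrable_annulus _ _ _ 1).
    apply: measurable_funM.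
      rewrite (_ : (fun x : R => (`|x| `^ q)^-1) = (fun x => `|x| `^ (- q))).
        exact: measurable_normr_powR.
      by apply/funext => x; rewrite powRN.
    have mc k : measurable_fun setT (a k).
      by apply: measurable_funM => //; exact: measurable_cos_phase.
    have ms k : measurable_fun setT (b k).
      by apply: measurable_funM => //; exact: measurable_sin_phase.
    by apply: measurable_funD; apply: measurable_funM.
  move=> x /andP[Mx _]; rewrite abE normrM -[leRHS]mulr1.
  apply: ler_pM => //.
    rewrite ger0_norm ?invr_ge0 ?powR_ge0// invf_le1; last first.
      by apply: powR_gt0; apply: lt_trans Mx.
    by rewrite ltW// powR_gt1//; apply: le_lt_trans Mx.
  rewrite normrM -[leRHS]mulr1; apply: ler_pM => //.
    by case: (`|x| <= _); rewrite ?normr1 ?normr0.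
  by rewrite ler_norml cos_geN1 cos_le1.
by rewrite lerD2r ler_wpM2l// divr_ge0// ltW.
Qed.

End WaveIntegral.

(** * Energies of alpha-dimensional measures *)

Lemma powR_exprn (R : realType) (x s : R) (n : nat) : 0 <= x ->
  (x ^+ n) `^ s = (x `^ s) ^+ n.
Proof.
move=> x0; elim: n => [|n ih]; first by rewrite !expr0 powR1.
by rewrite !exprS powRM ?exprn_ge0// ih.
Qed.

Lemma half_exprn_lt (R : realType) (e : R) : 0 < e ->
  exists K : nat, (2^-1 : R) ^+ K < e.
Proof.
move=> e0; exists (Num.truncn e^-1).+1.
set K := (Num.truncn e^-1).+1.
have eK : e^-1 < K%:R by exact: truncnS_gt.
have K0 : 0 < K%:R :> R by rewrite ltr0n.
rewrite exprVn invf_plt ?posrE ?exprn_gt0//.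
by apply: (lt_trans eK); rewrite -natrX ltr_nat ltn_expl.
Qed.

Lemma geometric_sum_le (R : realType) (x : R) (n : nat) : 0 <= x < 1 ->
  \sum_(j < n) x ^+ j <= (1 - x)^-1.
Proof.
move=> /andP[x0 x1]; have x10 : 0 < 1 - x by lra.
rewrite -[leRHS]mul1r ler_pdivlMr// mulrC -opprB mulNr -subrX1.
by rewrite opprB lerBlDr lerDl exprn_ge0.
Qed.

Section RieszSum.
Variables (R : realType) (mu : {measure set R -> \bar R}) (alpha beta c : R).
Hypotheses (c0 : 0 <= c) (beta0 : 0 < beta) (ab : beta < alpha).
Hypothesis hmu : forall x r : R, 0 < r -> (mu (ball x r) <= (c * r `^ alpha)%:E)%E.
Variables (n : nat) (A : 'I_n -> set R) (xs : 'I_n -> R) (delta : R).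
Hypotheses (d0 : 0 < delta) (mA : forall i, measurable (A i))
  (trivA : trivIset setT A) (Aball : forall i, A i `<=` ball (xs i) delta).

Local Notation p i := (fine (mu (A i))).

Lemma cell_fin_num i : mu (A i) \is a fin_num.
Proof.
rewrite ge0_fin_numE//; apply: (@le_lt_trans _ _ (mu (ball (xs i) delta))).
  by apply: le_measure; rewrite ?inE//; exact: measurable_ball.
by apply: le_lt_trans (hmu _ d0) _; rewrite ltry.
Qed.

Lemma cell_sum_ball (P : pred 'I_n) (y r : R) : 0 < r ->
  (forall i, P i -> A i `<=` ball y r) ->
  \sum_(i | P i) p i <= c * r `^ alpha.
Proof.
move=> r0 Pr; rewrite -lee_fin -sumEFin.
apply: le_trans (hmu y r0).
rewrite (eq_bigr (fun i => mu (A i))); last first.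
  by move=> i _; rewrite fineK// cell_fin_num.
rewrite -measure_bigsetU_ord//.
apply: le_measure; rewrite ?inE//.
- by apply: bigsetU_measurable => i _; exact: mA.
- exact: measurable_ball.
- apply: (big_ind (fun U => U `<=` ball y r)) => //.
  by move=> U V hU hV x [/hU|/hV].
Qed.

(** Dyadic shells: where [|y - xs i|] is about [2^-j], the weight is at most [2^((j + 1) beta)], and
    the cells lie in a ball of radius [2 * 2^-j]. The shells then form a geometric series of ratio
    [2^(beta - alpha)]. *)
Lemma riesz_sum_le (y : R) :
  \sum_(i | delta <= `|y - xs i| <= 1) p i * `|y - xs i| `^ (- beta) <=
  c * (2 `^ alpha * 2^-1 `^ (- beta)) / (1 - 2^-1 `^ (alpha - beta)).
Proof.
pose a : R := 2^-1.
have a0 : 0 < a by rewrite invr_gt0.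
have a1 : a < 1 by rewrite invf_lt1// ltr1n.
(* Distances are at least [delta], so [K] shells suffice. *)
have [K hK] := half_exprn_lt d0.
(* [S j] is a ball rather than a shell: an index may be counted several times, which only enlarges
   the sum. The last condition makes cells of radius [delta] fit in the doubled ball. *)
pose S j i := [&& delta <= `|y - xs i|, `|y - xs i| <= a ^+ j & delta <= a ^+ j].
have p0 i : 0 <= p i by apply: fine_ge0.
pose bnd := \sum_(j < K) \sum_(i | S j i) p i * (a ^+ j.+1) `^ (- beta).
apply: (@le_trans _ _ bnd).
  rewrite /bnd; under [leRHS]eq_bigr do rewrite big_mkcond.
  rewrite exchange_big /= big_mkcond /=; apply: ler_sum => i _.
  case: ifPn => [/andP[di i1]|_]; last first.
    by apply: sumr_ge0 => j _; case: ifP => // _; rewrite mulr_ge0 ?powR_ge0.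
  (* The least such [j] is the shell of [i]: minimality gives the upper bound [a ^+ j], and for
     [j = 0] it is the hypothesis that the distance is at most 1. *)
  have ex : exists j, a ^+ j.+1 < `|y - xs i|.
    exists K; rewrite exprS; apply: lt_le_trans di; apply: le_lt_trans hK.
    by rewrite ler_piMl ?exprn_ge0// ltW.
  case: (ex_minnP ex) => j hj minj.
  have ri : `|y - xs i| <= a ^+ j.
    case: j hj minj => [_ _|j _ minj]; first by rewrite expr0.
    by rewrite leNgt; apply/negP => /minj; rewrite ltnn.
  have jK : (j < K)%N.
    rewrite ltnNge; apply/negP => Kj.
    have : a ^+ j <= a ^+ K by apply: ler_wiXn2l => //; exact: ltW.
    by move=> h; have := le_lt_trans (le_trans (le_trans di ri) h) hK; rewrite ltxx.
  rewrite (bigD1 (Ordinal jK)) //= -[leLHS]addr0; apply: lerD.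
    rewrite /S di ri (le_trans di ri) /=.
    rewrite ler_wpM2l//; apply: powR_le_base_neg; last exact: ltW.
      by rewrite oppr_le0 ltW.
    by rewrite exprn_gt0.
  apply: sumr_ge0 => k _; case: ifP => // _.
  by rewrite mulr_ge0 ?powR_ge0.
apply: (@le_trans _ _ (\sum_(j < K) c * (2 `^ alpha * a `^ (- beta)) *
    (a `^ (alpha - beta)) ^+ j)).
  apply: ler_sum => j _; rewrite -mulr_suml.
  have ajd : 0 < a ^+ j by rewrite exprn_gt0.
  apply: (@le_trans _ _ (c * (2 * a ^+ j) `^ alpha * (a ^+ j.+1) `^ (- beta))).
    rewrite ler_wpM2r ?powR_ge0//; apply: (@cell_sum_ball _ y).
      by rewrite mulr_gt0.
    move=> i /and3P[_ ri da] x /Aball; rewrite /ball /= => hx.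
    have -> : y - x = (y - xs i) + (xs i - x) by ring.
    apply: le_lt_trans (ler_normD _ _) _; lra.
  rewrite powRM ?(ltW ajd)// !powR_exprn ?(ltW a0)// exprS powRD; last first.
    by rewrite (gt_eqF a0) implybT.
  by rewrite exprMn le_eqVlt; apply/orP; left; apply/eqP; ring.
rewrite -mulr_sumr ler_wpM2l ?mulr_ge0 ?powR_ge0//.
apply: geometric_sum_le; rewrite powR_ge0 /=.
by apply: powR_lt1; rewrite ?subr_gt0// ltW.
Qed.

End RieszSum.

(** * The maximal estimate *)

Section Maximal.
Variables (R : realType) (m q kappa : R) (gamma : R -> R -> R) (C1 C2 : R).
Hypotheses (hq : 1 / 2 < q) (hq1 : q < 1) (hm : 1 < m) (hk : 0 < kappa)
  (C10 : 0 < C1) (C20 : 0 < C2).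
Hypothesis holder : forall x t t' : R, -1 <= t <= 1 -> -1 <= t' <= 1 ->
  `|gamma x t - gamma x t'| <= C1 * `|t - t'| `^ kappa.
Hypothesis bilip : forall t x x' : R, -1 <= t <= 1 ->
  C2^-1 * `|x - x'| <= `|gamma x t - gamma x' t|.

(* If [|t - t'|^kappa] is small compared with [|x - y|], the points of the two
   curves are [|x - y|]-separated; otherwise the times are. *)
Lemma kernel_curve_bound (beta : R) :
  1 - q <= beta -> (1 - q) / (m * kappa) <= beta ->
  exists2 C, 0 < C & forall x y t t' th M N : R, 1 <= M -> M <= N ->
    -1 <= t <= 1 -> -1 <= t' <= 1 -> 0 < `|x - y| <= 1 ->
    `|kernel m q (gamma x t - gamma y t') (t - t') th M N| <=
    C * `|x - y| `^ (- beta).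
Proof.
move: (hq) (hq1) (hm) (hk) (C10) (C20) => hq' hq1' hm' hk' C10' C20' b1 b2.
have q0 : 0 < q by lra.
have m0 : 0 < m by lra.
have [CA CA0 hA] := osc_bound_space hq hq1 hm.
have [CB CB0 hB] := osc_bound_time hq hq1 hm.
(* Separation at a fixed time gives [2 r / D], and the first case below loses at most [r / D] to the
   change of time. [D'] is the resulting threshold for [|t - t'| ^ kappa]. *)
pose D := 2 * C2.
have D0 : 0 < D by rewrite mulr_gt0.
pose D' := D * C1.
have D'0 : 0 < D' by rewrite mulr_gt0.
pose K1 := 2 * CA * D^-1 `^ (q - 1).
pose e := (q - 1) / (m * kappa).
pose K2 := 2 * CB * D'^-1 `^ e.
have K10 : 0 < K1 by rewrite mulr_gt0 ?mulr_gt0 ?powR_gt0 ?invr_gt0.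
have K20 : 0 < K2 by rewrite mulr_gt0 ?mulr_gt0 ?powR_gt0 ?invr_gt0.
exists (K1 + K2); first exact: addr_gt0.
move=> x y t t' th M N M1 MN ht ht' /andP[r0 r1].
pose r : R := `|x - y|; rewrite -/r.
have {}r0 : 0 < r by []; have {}r1 : r <= 1 by [].
have M0 : 0 < M by lra.
have rb0 : 0 < r `^ (- beta) by exact: powR_gt0.
have [hT|hT] := leP (C1 * `|t - t'| `^ kappa) (r / D).
- have hX : r / D <= `|gamma x t - gamma y t'|.
    have h1 := bilip x y ht; have h2 := holder y ht ht'.
    have h3 : gamma x t - gamma y t =
      (gamma x t - gamma y t') - (gamma y t - gamma y t') by ring.
    have h4 : `|gamma x t - gamma y t| <=
      `|gamma x t - gamma y t'| + `|gamma y t - gamma y t'|.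
      by rewrite {1}h3; exact: ler_normB.
    have h5 : C2^-1 * r = r / D + r / D.
      by rewrite /D; field; rewrite gt_eqF.
    move: h1; rewrite -/r; lra.
  have rD0 : 0 < r / D by rewrite divr_gt0.
  set X := gamma x t - gamma y t' in hX *.
  have X0 : X != 0 by rewrite -normr_gt0; lra.
  have NX0 : - X != 0 by rewrite oppr_eq0.
  have := hA _ (t - t') NX0; rewrite normrN => oN.
  have := @kernel_bound R q m X (t - t') th (fun=> True) _ M N q0 M0 MN I I
    (hA X (t - t') X0) oN.
  move=> h; apply: (le_trans h).
  have h2 : `|X| `^ (q - 1) <= D^-1 `^ (q - 1) * r `^ (- beta).
    apply: (@le_trans _ _ ((r / D) `^ (q - 1))).
      by apply: powR_le_base_neg => //; lra.
    rewrite powRM; [|exact: ltW|by rewrite invr_ge0 ltW].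
      rewrite [leLHS]mulrC ler_wpM2l ?powR_ge0//.
    apply: ger_powR; first by rewrite r0.
    lra.
  have h3 : 2 * CA * `|X| `^ (q - 1) <= K1 * r `^ (- beta).
    by rewrite /K1 -!mulrA ler_pM2l// ler_pM2l.
  rewrite -mulr2n -mulr_natl mulrA; apply: (le_trans h3).
  by rewrite ler_pM2r// lerDl ltW.
- have T0 : t - t' != 0.
    apply/eqP => t0; move: hT; rewrite t0 normr0 powR0 ?gt_eqF// mulr0 => h.
    have : 0 < r / D by rewrite divr_gt0.
    lra.
  have aT0 : 0 < `|t - t'| by rewrite normr_gt0.
  set X := gamma x t - gamma y t'.
  have := @kernel_bound R q m X (t - t') th (fun=> True) _ M N q0 M0 MN I I
    (hB X _ T0) (hB (- X) _ T0).
  move=> h; apply: (le_trans h).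
  have h2 : `|t - t'| `^ ((q - 1) / m) <= D'^-1 `^ e * r `^ (- beta).
    (* The case hypothesis controls [|t - t'| ^ kappa] only; passing to this power brings in the
       factor [1 / kappa]. *)
    have -> : `|t - t'| `^ ((q - 1) / m) = (`|t - t'| `^ kappa) `^ e.
      by rewrite -powRrM /e; congr (_ `^ _); field; rewrite !gt_eqF.
    have e0 : e <= 0.
      by apply: mulr_le0_ge0; [lra|rewrite invr_ge0 mulr_ge0// ltW].
    apply: (@le_trans _ _ ((r / D') `^ e)).
      apply: powR_le_base_neg => //; first by rewrite divr_gt0.
      rewrite /D' invfM mulrA ler_pdivrMr// [leRHS]mulrC; exact: ltW.
    rewrite powRM; [|exact: ltW|by rewrite invr_ge0 ltW].
      rewrite [leLHS]mulrC ler_wpM2l ?powR_ge0//.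
    apply: ger_powR; first by rewrite r0.
    have -> : e = - ((1 - q) / (m * kappa)) by rewrite /e; ring.
    by rewrite lerN2.
  have h3 : 2 * CB * `|t - t'| `^ ((q - 1) / m) <= K2 * r `^ (- beta).
    by rewrite /K2 -!mulrA ler_pM2l// ler_pM2l.
  rewrite -mulr2n -mulr_natl mulrA; apply: (le_trans h3).
  by rewrite ler_pM2r// lerDr ltW.
Qed.

(** On the annulus the amplitude is at most 1. The bound serves for points so close that the decay
    estimate is of no use, including equal points. *)
Lemma kernel_trivial_bound (X T th M N n : R) : 1 <= M -> M <= N -> N <= n ->
  `|kernel m q X T th M N| <= 2 * n.
Proof.
move: (hq) => hq' M1 MN Nn.
have q0 : 0 < q by lra.
have M0 : 0 < M by lra.
have := @kernel_bound R q m X T th (fun x => 1 <= x <= n) _ M N q0 M0 MN _ _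
  (@osc_on_segment R q m hq 1 n X T ltr01)
  (@osc_on_segment R q m hq 1 n (- X) T ltr01).
rewrite powR1 mul1r => h; apply: le_trans (h _ _) _; last lra.
  by rewrite M1 (le_trans MN).
by rewrite Nn (le_trans M1).
Qed.

Variables (g1 g2 : R -> R).
Local Notation leb := (@lebesgue_measure R).
Hypotheses
  (ig1 : forall N, leb.-integrable `[- N, N] (EFin \o g1))
  (ig2 : forall N, leb.-integrable `[- N, N] (EFin \o g2)).
Variables (mu : {measure set R -> \bar R}) (alpha beta c : R).
Hypotheses (c0 : 0 <= c) (ab : beta < alpha).
Hypotheses (b1 : 1 - q <= beta) (b2 : (1 - q) / (m * kappa) <= beta).
Hypothesis hmu : forall x r : R, 0 < r -> (mu (ball x r) <= (c * r `^ alpha)%:E)%E.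

(** As [th] is free, the one-sided inequality already expresses that the modulus of the complex
    integral exceeds [lam]. *)
Definition large_wave (lam M n x : R) : Prop := exists N t th : R,
  [/\ M <= N <= n, -1 <= t <= 1 &
    lam < \int[leb]_(y in annulus M N) wave m g1 g2 (gamma x t) t th y].

(** A weak-type estimate through a row-sum test on the kernel matrix. The unit window keeps
    distances at most 1. The number of cells depends on [n], but [C] does not. *)
Lemma maximal_bound : exists2 C, 0 < C &
  forall (lam M n E z : R) (O : set R), 0 < lam -> 1 <= M -> M <= n ->
    measurable O ->
    leb.-integrable (annulus M n) (EFin \o energy_density q g1 g2) ->
    \int[leb]_(x in annulus M n) energy_density q g1 g2 x <= E ->
    O `<=` large_wave lam M n ->
    (mu (O `&` `[z, (z + 1)%R[) <= (C * E / lam ^+ 2)%:E)%E.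
Proof.
move: (hq) (hq1) (hm) (hk) (c0) (b1) => hq' hq1' hm' hk' c0' b1'.
have beta0 : 0 < beta by lra.
have alpha0 : 0 < alpha by apply: lt_trans ab.
have q0 : 0 < q by lra.
have [CK CK0 hCK] := kernel_curve_bound b1 b2.
pose CR := c * (2 `^ alpha * 2^-1 `^ (- beta)) / (1 - 2^-1 `^ (alpha - beta)).
have CR0 : 0 <= CR.
  rewrite divr_ge0 ?mulr_ge0 ?powR_ge0// subr_ge0 ltW// powR_lt1 ?invr_ge0//.
    by rewrite subr_gt0.
  by rewrite invf_lt1// ltr1n.
(* 1 bounds the near-diagonal part of a row, [CK * CR] the rest. *)
pose C := 1 + CK * CR.
have C0 : 0 < C by rewrite ltr_wpDr// mulr_ge0// ltW.
exists C => // lam M n E z O lam0 M1 Mn mO iE hE Olarge.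
have n0 : 0 < n by lra.
(* the near-diagonal part of the kernel is negligible for small cells *)
have [Q [Q0 hQ]] : exists Q : nat, (0 < Q)%N /\
    2 * n * (c * (2 / Q%:R) `^ alpha) <= 1.
  pose w := 2 * n * c * 2 `^ alpha.
  have w0 : 0 <= w by rewrite !mulr_ge0 ?powR_ge0// ltW.
  pose v := (1 + w) `^ alpha^-1.
  have v0 : 0 < v by rewrite powR_gt0//; lra.
  exists (Num.truncn v).+1; split => //.
  set Q := (Num.truncn v).+1.
  have vQ : v <= Q%:R by rewrite ltW// truncnS_gt.
  have Q0 : 0 < Q%:R :> R by rewrite ltr0n.
  rewrite powR_div// (_ : _ * _ = w / Q%:R `^ alpha); last first.
    by rewrite /w; ring.
  rewrite ler_pdivrMr ?powR_gt0// mul1r.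
  apply: (@le_trans _ _ (v `^ alpha)); last first.
    by apply: powR_le_base => //; exact: ltW.
  by rewrite /v -powRrM mulVf ?gt_eqF// powRr1; lra.
have QR0 : 0 < Q%:R :> R by rewrite ltr0n.
pose cell (i : 'I_Q) : set R := `[z + i%:R / Q%:R, (z + i.+1%:R / Q%:R)%R[%classic.
pose A i := O `&` cell i.
have mA i : measurable (A i) by apply: measurableI => //; exact: measurable_itv.
have trivA : trivIset setT A.
  apply/trivIsetP => i j _ _ ij; apply/seteqP; split => // x [[_ ci] [_ cj]].
  have lt_cell (k l : 'I_Q) : cell k x -> cell l x -> (k <= l)%N.
    rewrite /cell /= !in_itv /= => /andP[h1 _] /andP[_ h2].
    have : z + k%:R / Q%:R < z + l.+1%:R / Q%:R by apply: le_lt_trans h2.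
    by rewrite ltrD2l ltr_pM2r ?invr_gt0// ltr_nat ltnS.
  by case/negP: ij; apply/eqP/val_inj/eqP; rewrite eqn_leq !lt_cell.
have cellE i x y : cell i x -> cell i y -> `|x - y| < Q%:R^-1.
  rewrite /cell /= !in_itv /= => /andP[h1 h2] /andP[h3 h4].
  have e : i.+1%:R / Q%:R = i%:R / Q%:R + Q%:R^-1 :> R.
    by rewrite -natr1 mulrDl mul1r.
  by rewrite ltr_norml; apply/andP; split; lra.
have cell_unit i x : cell i x -> z <= x < z + 1.
  rewrite /cell /= in_itv /= => /andP[h1 h2]; apply/andP; split.
    by apply: le_trans h1; rewrite lerDl divr_ge0// ltW.
  apply: (lt_le_trans h2); rewrite lerD2l ler_pdivrMr// mul1r ler_nat.
  exact: ltn_ord.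
have cover : O `&` `[z, z + 1[ `<=` \big[setU/set0]_(i < Q) A i.
  move=> x [Ox]; rewrite /= in_itv /= => /andP[zx xz].
  have h0 : 0 <= (x - z) * Q%:R by rewrite mulr_ge0 ?subr_ge0 ?ler0n.
  have /andP[k1 k2] := truncn_itv h0.
  have kQ : (Num.truncn ((x - z) * Q%:R) < Q)%N.
    rewrite truncn_lt_nat// -[ltRHS]mul1r ltr_pM2r//; lra.
  rewrite (bigD1 (Ordinal kQ)) //=; left; split => //.
  rewrite /cell /= in_itv /=; apply/andP; split.
    by rewrite addrC -lerBrDr ler_pdivrMr.
  by rewrite addrC -ltrBlDr ltr_pdivlMr.
(* linearize: a point, a time, a cutoff and a phase in each cell *)
have pick i : exists w : R * R * R * R, let: (x, N, t, th) := w in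
    [/\ cell i x, M <= N <= n, -1 <= t <= 1 &
      A i !=set0 ->
      lam < \int[leb]_(y in annulus M N) wave m g1 g2 (gamma x t) t th y].
  have [[x [Ox cx]]|nA] := pselect (A i !=set0).
    by have [N [t [th [h1 h2 h3]]]] := Olarge _ Ox; exists (x, N, t, th).
  (* Dummy data for an empty cell: its mass is 0, so it contributes nothing below. *)
  exists (z + i%:R / Q%:R, M, 0, 0); split => //.
  - rewrite /cell /= in_itv /= lexx ltrD2l ltr_pM2r ?invr_gt0//.
    by rewrite /= ltr_nat.
  - by rewrite lexx.
  - by rewrite lerN10 ler01.
have {pick} [w hw] := choice pick.
pose xs i := (w i).1.1.1; pose N i := (w i).1.1.2.
pose t i := (w i).1.2; pose th i := (w i).2.
have cxs i : cell i (xs i).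
  by have := hw i; rewrite /xs; case: (w i) => [[[? ?] ?] ?] [].
have hN i : M <= N i <= n.
  by have := hw i; rewrite /N; case: (w i) => [[[? ?] ?] ?] [].
have ht i : -1 <= t i <= 1.
  by have := hw i; rewrite /t; case: (w i) => [[[? ?] ?] ?] [].
have hlam i : A i !=set0 -> lam < \int[leb]_(y in annulus M (N i))
    wave m g1 g2 (gamma (xs i) (t i)) (t i) (th i) y.
  have := hw i; rewrite /t /xs /N /th.
  by case: (w i) => [[[? ?] ?] ?] [].
pose p i := fine (mu (A i)).
have p0 i : 0 <= p i by apply: fine_ge0.
have dQ : 0 < Q%:R^-1 :> R by rewrite invr_gt0.
have Aball i : A i `<=` ball (xs i) Q%:R^-1.
  by move=> x [_ cx]; rewrite /ball /=; exact: cellE (cxs i) cx.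
pose S := \sum_i p i.
have muS : (mu (O `&` `[z, (z + 1)%R[) <= S%:E)%E.
  apply: (@le_trans _ _ (mu (\big[setU/set0]_(i < Q) A i))).
    apply: le_measure; rewrite ?inE//.
      by apply: measurableI => //; exact: measurable_itv.
    by apply: bigsetU_measurable => i _; exact: mA.
  rewrite measure_bigsetU_ord// /S -sumEFin.
  apply: lee_sum => i _; rewrite /p fineK//.
  exact: (cell_fin_num hmu dQ mA Aball).
pose Ker i j := kernel m q (gamma (xs i) (t i) - gamma (xs j) (t j)) (t i - t j)
  (th i - th j) M (Num.min (N i) (N j)).
have rowle i : \sum_j p j * `|Ker i j| <= C.
  rewrite (bigID (fun j => `|xs i - xs j| < Q%:R^-1)) /=; apply: lerD.
    apply: (@le_trans _ _ (\sum_(j | `|xs i - xs j| < Q%:R^-1) p j * (2 * n))).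
      apply: ler_sum => j _; rewrite ler_wpM2l//.
      have /andP[? ?] := hN i; have /andP[? ?] := hN j.
      apply: kernel_trivial_bound => //.
        by rewrite le_min; apply/andP; split.
      by rewrite ge_min; apply/orP; left.
    rewrite -mulr_suml; apply: le_trans hQ.
    rewrite mulrC ler_wpM2l ?mulr_ge0 ?(ltW n0)//.
    apply: (cell_sum_ball hmu dQ mA trivA Aball (y := xs i)).
      by rewrite divr_gt0.
    move=> j hj x /Aball; rewrite /ball /= => hx.
    have -> : xs i - x = (xs i - xs j) + (xs j - x) by ring.
    by apply: le_lt_trans (ler_normD _ _) _; lra.
  apply: (@le_trans _ _ (CK * \sum_(j | Q%:R^-1 <= `|xs i - xs j| <= 1)
      p j * `|xs i - xs j| `^ (- beta))); last first.
    rewrite ler_wpM2l ?(ltW CK0)//.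
    exact: (riesz_sum_le c0 beta0 ab hmu dQ mA trivA Aball).
  rewrite mulr_sumr; under eq_bigl do rewrite -leNgt.
  have hle1 j : `|xs i - xs j| <= 1.
    have /andP[? ?] := cell_unit _ _ (cxs i).
    have /andP[? ?] := cell_unit _ _ (cxs j).
    by rewrite ler_norml; apply/andP; split; lra.
  under [leRHS]eq_bigl do rewrite hle1 andbT.
  apply: ler_sum => j hj; rewrite mulrCA ler_wpM2l//.
  have /andP[? ?] := hN i; have /andP[? ?] := hN j.
  apply: hCK => //.
    by rewrite le_min; apply/andP; split.
  by rewrite hle1 andbT; apply: lt_le_trans hj.
(* With this choice the kernel term is at most [lam * S / 2] and is absorbed by the left-hand side
   [lam * S]. *)
pose tau := C / lam.
have tau0 : 0 < tau by rewrite divr_gt0.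
have dual := @wave_dual_bound R m q g1 g2 q0 ig1 ig2 'I_Q p
  (fun i => gamma (xs i) (t i)) t th N M n tau E M1 tau0
  (fun i => proj2 (elimT andP (hN i))) iE hE.
have low : lam * S <= \sum_i p i * \int[leb]_(y in annulus M (N i))
    wave m g1 g2 (gamma (xs i) (t i)) (t i) (th i) y.
  rewrite /S mulr_sumr; apply: ler_sum => i _; rewrite mulrC.
  have [/hlam/ltW h|nA] := pselect (A i !=set0).
    by rewrite ler_wpM2l.
  have -> : p i = 0; last by rewrite !mul0r.
  rewrite /p (_ : A i = set0) ?measure0//.
  by apply/seteqP; split => // x Ax; apply: nA; exists x.
have high : \sum_i \sum_j p i * p j * Ker i j <= C * S.
  rewrite /S mulr_sumr; apply: ler_sum => i _.
  rewrite mulrC; apply: le_trans (_ : p i * \sum_j p j * `|Ker i j| <= _).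
    rewrite mulr_sumr; apply: ler_sum => j _; rewrite -mulrA.
    by rewrite !ler_wpM2l// ler_norm.
  by rewrite ler_wpM2l.
apply: (le_trans muS); rewrite lee_fin.
have h1 : (2 * tau)^-1 * (C * S) = lam * S / 2.
  by rewrite /tau; field; rewrite !gt_eqF.
have h2 : (2 * tau)^-1 * (\sum_i \sum_j p i * p j * Ker i j) <= lam * S / 2.
  by rewrite -h1 ler_wpM2l// invr_ge0 mulr_ge0// ltW.
have h3 : lam * S <= tau * E by move: dual low h2; rewrite /Ker; lra.
rewrite ler_pdivlMr ?exprn_gt0// expr2 mulrA.
rewrite -ler_pdivlMr// mulrC (le_trans h3)// /tau.
by rewrite mulrAC.
Qed.

End Maximal.

(** * Integrability and tails of the Sobolev energy *)

Section EnergyTail.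
Variables (R : realType) (s : R) (g1 g2 : R -> R).
Hypotheses (s0 : 0 <= s).
Hypotheses (mg1 : measurable_fun setT g1) (mg2 : measurable_fun setT g2).
Local Notation leb := (@lebesgue_measure R).

Definition sobolev_density (x : R) : R :=
  (1 + x ^+ 2) `^ s * (g1 x ^+ 2 + g2 x ^+ 2).

Hypothesis iG : leb.-integrable setT (EFin \o sobolev_density).

Lemma sobolev_density_ge (x : R) : g1 x ^+ 2 + g2 x ^+ 2 <= sobolev_density x.
Proof.
rewrite /sobolev_density ler_peMl ?addr_ge0 ?sqr_ge0//.
have h : 1 <= 1 + x ^+ 2 by rewrite lerDl sqr_ge0.
by rewrite -[leLHS](powRr0 (1 + x ^+ 2)); apply: ler_powR.
Qed.

Lemma sobolev_density_ge0 (x : R) : 0 <= sobolev_density x.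
Proof. by rewrite mulr_ge0 ?powR_ge0// addr_ge0 ?sqr_ge0. Qed.

Lemma segment_lty (N : R) : (leb `[(- N)%R, N] < +oo)%E.
Proof.
rewrite lebesgue_measure_itv /=; case: ifPn => // _.
by rewrite -EFinB ltry.
Qed.

Lemma integrable_segment_of_sqr (h : R -> R) (N : R) : measurable_fun setT h ->
  (forall x, h x ^+ 2 <= sobolev_density x) ->
  leb.-integrable `[- N, N] (EFin \o h).
Proof.
move=> mh hG.
have i1 : leb.-integrable `[- N, N] (EFin \o (fun x => 1 + sobolev_density x)).
  have c1 : leb.-integrable `[- N, N] (EFin \o cst (1 : R)).
    apply: measurable_bounded_integrable => //.
      exact: segment_lty.
    exact: bounded_cst.
  have c2 : leb.-integrable `[- N, N] (EFin \o sobolev_density).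
    by apply: integrableS iG => //.
  have mI : measurable `[- N, N]%classic by [].
  have := @integrableD _ _ _ leb _ mI _ _ c1 c2.
  by apply: eq_integrable.
apply: le_integrable i1 => //.
  by apply/measurable_EFinP; exact: measurable_funTS.
move=> x _ /=; rewrite lee_fin.
have h0 := sobolev_density_ge0 x.
rewrite (ger0_norm (_ : 0 <= 1 + sobolev_density x)); last first.
  by rewrite addr_ge0.
(* The square yields [|h| <= 1 + h ^ 2], which is integrable on a bounded segment. *)
have := hG x; have : 0 <= (`|h x| - 1) ^+ 2 by exact: sqr_ge0.
rewrite -(real_normK (num_real (h x))).
have := normr_ge0 (h x); rewrite !expr2; nra.
Qed.

Lemma integrable_segment_g1 N : leb.-integrable `[- N, N] (EFin \o g1).
Proof.
apply: integrable_segment_of_sqr => // x.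
by apply: le_trans (sobolev_density_ge x); rewrite lerDl sqr_ge0.
Qed.

Lemma integrable_segment_g2 N : leb.-integrable `[- N, N] (EFin \o g2).
Proof.
apply: integrable_segment_of_sqr => // x.
by apply: le_trans (sobolev_density_ge x); rewrite lerDr sqr_ge0.
Qed.

Lemma Rintegral_annulus (M N : R) (f : R -> R) : 0 <= M -> M <= N ->
  leb.-integrable `[- N, N] (EFin \o f) ->
  \int[leb]_(x in annulus M N) f x =
  \int[leb]_(x in `[- N, N]) f x - \int[leb]_(x in `[- M, M]) f x.
Proof.
move=> M0 MN fi.
have -> : `[- N, N]%classic = `[- M, M] `|` annulus M N.
  apply/seteqP; split => x; rewrite /annulus /= !in_itv /= -!ler_norml.
    by move=> xN; case: (leP `|x| M) => h; [left|right].
  by case=> [h|/andP[_]//]; apply: le_trans MN.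
rewrite Rintegral_setU//=.
- by rewrite addrAC subrr add0r.
- exact: measurable_annulus.
- suff <- : `[- N, N]%classic = `[- M, M] `|` annulus M N by [].
  apply/seteqP; split => x; rewrite /annulus /= !in_itv /= -!ler_norml.
    by move=> xN; case: (leP `|x| M) => h; [left|right].
  by case=> [h|/andP[_]//]; apply: le_trans MN.
- apply/disj_setPS => x [/=]; rewrite /annulus in_itv /= -ler_norml.
  by move=> h /andP[]; rewrite ltNge h.
Qed.

(** For [1 <= |x|] one has [|x| ^ q <= |x| ^ (2 s) <= (1 + x ^ 2) ^ s]. *)
Lemma integrable_energy (q M N : R) : 1 <= M -> q <= 2 * s ->
  leb.-integrable (annulus M N) (EFin \o energy_density q g1 g2) /\
  (forall x, annulus M N x -> energy_density q g1 g2 x <= sobolev_density x).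
Proof.
move=> M1 qs.
have le x : annulus M N x -> energy_density q g1 g2 x <= sobolev_density x.
  move=> /andP[Mx _]; rewrite ler_wpM2r ?addr_ge0 ?sqr_ge0//.
  have x1 : 1 <= `|x| by rewrite ltW// (le_lt_trans M1).
  apply: (@le_trans _ _ (`|x| `^ (2 * s))); first exact: ler_powR.
  rewrite powRrM powR_mulrn// real_normK ?num_real//.
  by apply: powR_le_base; rewrite ?sqr_ge0// lerDr.
split => //.
have i1 : leb.-integrable (annulus M N) (EFin \o sobolev_density).
  by apply: integrableS iG => //; exact: measurable_annulus.
apply: le_integrable i1 => //; first exact: measurable_annulus.
  apply/measurable_EFinP; apply: measurable_funTS; apply: measurable_funM.
    exact: measurable_normr_powR.
  by apply: measurable_funD; exact: measurable_funX.
move=> x hx /=; rewrite lee_fin !ger0_norm ?sobolev_density_ge0 ?le//.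
by rewrite mulr_ge0 ?powR_ge0// addr_ge0 ?sqr_ge0.
Qed.

(** By monotone convergence the density on [[- k, k]] has almost the full mass, so what lies outside
    is small uniformly in [n]. *)
Lemma energy_tail (q eps : R) : q <= 2 * s -> 0 < eps ->
  exists k : nat, (0 < k)%N /\ forall n : R, k%:R <= n ->
    \int[leb]_(x in annulus k%:R n) energy_density q g1 g2 x <= eps.
Proof.
move=> qs eps0.
pose F (k : nat) : set R := `[- k%:R, k%:R]%classic.
have mG : measurable_fun setT (EFin \o sobolev_density).
  by have /integrableP[] := iG.
have FT : \bigcup_k F k = setT.
  apply/seteqP; split => // x _; exists (Num.truncn `|x|).+1 => //.
  by rewrite /F /= in_itv /= -ler_norml ltW// truncnS_gt.
have cvgF : (\int[leb]_(x in F k) (sobolev_density x)%:E)%E @[k --> \oo] -->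
    (\int[leb]_x (sobolev_density x)%:E)%E.
  rewrite -FT; apply: ge0_nondecreasing_set_cvg_integral => //.
  - apply/nondecreasing_seqP => k; rewrite subsetEset.
    move=> x; rewrite /F /= !in_itv /= -!ler_norml => h.
    by apply: le_trans h _; rewrite ler_nat.
  - by move=> k; exact: measurable_itv.
  - by move=> k; exact: measurable_funTS.
  - by move=> k x _; rewrite lee_fin sobolev_density_ge0.
pose I := \int[leb]_x sobolev_density x.
have EI : (\int[leb]_x (sobolev_density x)%:E)%E = I%:E.
  by rewrite /I /Rintegral fineK//; exact: integrable_fin_num.
pose J (k : nat) := \int[leb]_(x in F k) sobolev_density x.
have iF k : leb.-integrable (F k) (EFin \o sobolev_density).
  by apply: integrableS iG => //; exact: measurable_itv.
have EJ k : (\int[leb]_(x in F k) (sobolev_density x)%:E)%E = (J k)%:E.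
  rewrite /J /Rintegral fineK//; apply: integrable_fin_num (iF k).
  exact: measurable_itv.
have JI n : \int[leb]_(x in `[- n, n]) sobolev_density x <= I.
  rewrite -lee_fin -EI /Rintegral fineK; last first.
    by apply: integrable_fin_num => //; apply: integrableS iG.
  apply: ge0_subset_integral => //.
  by move=> x _; rewrite lee_fin sobolev_density_ge0.
have {}cvgF : J k @[k --> \oo] --> I.
  have h : (J k)%:E @[k --> \oo] --> I%:E.
    by move: cvgF; rewrite EI; under eq_fun do rewrite EJ.
  exact: (fine_cvg h).
have /cvgrPdist_le h := cvgF.
have [k0 _ hk0] := h eps eps0.
(* The successor ensures [1 <= k], where the homogeneous weight is dominated by the inhomogeneous
   one. *)
exists k0.+1; split => // n kn.
have k1 : 1 <= k0.+1%:R :> R by rewrite ler1n.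
have [iE le] := @integrable_energy q k0.+1%:R n k1 qs.
apply: (@le_trans _ _ (\int[leb]_(x in annulus k0.+1%:R n) sobolev_density x)).
  apply: le_Rintegral => //; first exact: measurable_annulus.
  by apply: integrableS iG => //; exact: measurable_annulus.
rewrite Rintegral_annulus ?ler0n//; last by apply: integrableS iG.
have := hk0 k0.+1 (leqnSn k0); rewrite /= ler_norml => /andP[_].
by move=> hJ; apply: le_trans hJ; apply: lerB => //; exact: JI.
Qed.

End EnergyTail.

(** * The exceptional set *)

Lemma dist_sin_cos_le (R : realType) (a b : R) :
  `|cos a - cos b| <= `|a - b| /\ `|sin a - sin b| <= `|a - b|.
Proof.
wlog ab : a b / b <= a.
  move=> h; have [ba|/ltW ab] := leP b a; first exact: h.
  by have [h1 h2] := h _ _ ab; rewrite distrC (distrC a) (distrC (sin a)).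
rewrite (ger0_norm (_ : 0 <= a - b)) ?subr_ge0//; split.
  apply: (@is_derive1_dist_le R cos (fun x => - sin x) id (fun=> 1)) => //.
  by move=> x _; rewrite normrN ler_norml sin_geN1 sin_le1.
apply: (@is_derive1_dist_le R sin cos id (fun=> 1)) => //.
by move=> x _; rewrite ler_norml cos_geN1 cos_le1.
Qed.

Section Exceptional.
Variables (R : realType) (m : R) (g1 g2 : R -> R).
Hypothesis (hm : 1 < m).
Local Notation leb := (@lebesgue_measure R).
Hypotheses
  (ig1 : forall N, leb.-integrable `[- N, N] (EFin \o g1))
  (ig2 : forall N, leb.-integrable `[- N, N] (EFin \o g2)).

Definition wave_mass (N : R) : R :=
  \int[leb]_(x in `[- N, N]) (`|g1 x| + `|g2 x|).

Lemma wave_mass_ge0 N : 0 <= wave_mass N.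
Proof. by apply: Rintegral_ge0 => x _; rewrite addr_ge0. Qed.

Lemma integrable_wave_segment N X T th :
  leb.-integrable `[- N, N] (EFin \o wave m g1 g2 X T th).
Proof. by apply: integrable_wave. Qed.

(** On [[- N, N]] the phases differ by at most [|X - X'| N + |T - T'| N ^ m], and sine and cosine
    are 1-Lipschitz. *)
Lemma wave_integral_lipschitz (N X T X' T' th : R) : 0 <= N ->
  `|\int[leb]_(x in `[- N, N]) wave m g1 g2 X T th x -
    \int[leb]_(x in `[- N, N]) wave m g1 g2 X' T' th x| <=
  (`|X - X'| * N + `|T - T'| * N `^ m) * wave_mass N.
Proof.
move=> N0.
set K := `|X - X'| * N + `|T - T'| * N `^ m.
have mI : measurable `[- N, N]%classic by exact: measurable_itv.
have i1 := integrable_wave_segment N X T th.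
have i2 := integrable_wave_segment N X' T' th.
have i12 : leb.-integrable `[- N, N]
    (EFin \o (fun x => wave m g1 g2 X T th x - wave m g1 g2 X' T' th x)).
  have := @integrableB _ _ _ leb _ mI _ _ i1 i2.
  by apply: eq_integrable.
have i3 : leb.-integrable `[- N, N] (EFin \o (fun x => `|g1 x| + `|g2 x|)).
  have := @integrableD _ _ _ leb _ mI _ _ (integrable_norm (ig1 N))
    (integrable_norm (ig2 N)).
  by apply: eq_integrable.
have i4 : leb.-integrable `[- N, N] (EFin \o (fun x => K * (`|g1 x| + `|g2 x|))).
  have := @integrableZl _ _ _ leb _ mI K _ i3.
  by apply: eq_integrable.
rewrite -RintegralB// /wave_mass -RintegralZl//.
have h12 := @le_normr_Rintegral _ _ _ leb _ _ (measurable_itv _) i12.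
apply: (le_trans h12).
apply: le_Rintegral => //; first exact: (integrable_norm i12).
move=> x; rewrite /= in_itv /= -ler_norml => xN.
have hphase : `|phase m X T th x - phase m X' T' th x| <= K.
  have -> : phase m X T th x - phase m X' T' th x =
      (X - X') * x + (T - T') * `|x| `^ m by rewrite /phase; ring.
  apply: le_trans (ler_normD _ _) _; rewrite !normrM; apply: lerD.
    by rewrite ler_wpM2l.
  rewrite ler_wpM2l// ger0_norm ?powR_ge0//.
  by apply: powR_le_base => //; rewrite ltW// (lt_trans ltr01).
have [hc hs] := dist_sin_cos_le (phase m X T th x) (phase m X' T' th x).
rewrite /wave.
have -> : forall c1 c2 s1 s2 u v : R, c1 * u - s1 * v - (c2 * u - s2 * v) =
  (c1 - c2) * u - (s1 - s2) * v by move=> *; ring.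
apply: le_trans (ler_normB _ _) _; rewrite !normrM mulrDr; apply: lerD.
  by rewrite ler_wpM2r// (le_trans hc).
by rewrite ler_wpM2r// (le_trans hs).
Qed.

Variables (gamma : R -> R -> R) (C2 : R).
Hypothesis C20 : 0 < C2.
Hypothesis lip : forall t x x' : R, -1 <= t <= 1 ->
  `|gamma x t - gamma x' t| <= C2 * `|x - x'|.

(** [M] is independent of [t]. Quantifying over [th] replaces absolute values and covers real and
    imaginary parts at once. *)
Definition uniformly_cauchy (x : R) : Prop := forall eps : R, 0 < eps ->
  exists2 M : R, 1 <= M & forall N t th : R, M <= N -> -1 <= t <= 1 ->
    \int[leb]_(y in annulus M N) wave m g1 g2 (gamma x t) t th y <= eps.

(** With [N], [t] and [th] kept fixed, the integral is Lipschitz in the point, so the strict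
    inequality persists nearby. Measurability follows from openness. *)
Lemma open_large_wave (lam M n : R) : 0 <= M ->
  open [set x | large_wave m gamma g1 g2 lam M n x].
Proof.
move=> M0; rewrite openE => x [N [t [th [/andP[MN Nn] ht hlam]]]].
have N0 : 0 <= N by apply: le_trans MN.
pose h y := \int[leb]_(z in annulus M N) wave m g1 g2 (gamma y t) t th z.
pose K := C2 * (N * wave_mass N + M * wave_mass M).
have K0 : 0 <= K.
  by rewrite mulr_ge0 ?(ltW C20)// addr_ge0 ?mulr_ge0 ?wave_mass_ge0.
have hL y : `|h x - h y| <= K * `|x - y|.
  rewrite /h !Rintegral_annulus//; try exact: integrable_wave_segment.
  have l1 := @wave_integral_lipschitz N (gamma x t) t (gamma y t) t th N0.
  have l2 := @wave_integral_lipschitz M (gamma x t) t (gamma y t) t th M0.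
  move: l1 l2; rewrite subrr normr0 !mul0r !addr0 => l1 l2.
  have -> : forall a b c d : R, a - b - (c - d) = (a - c) - (b - d).
    by move=> *; ring.
  apply: le_trans (ler_normB _ _) _.
  apply: le_trans (lerD l1 l2) _.
  have -> : K * `|x - y| =
      C2 * `|x - y| * (N * wave_mass N + M * wave_mass M) by rewrite /K; ring.
  rewrite -!mulrA -mulrDr mulrA; apply: ler_wpM2r; last exact: lip.
  by rewrite addr_ge0 ?mulr_ge0 ?wave_mass_ge0.
have K1 : 0 < K + 1 by lra.
have e0 : 0 < (h x - lam) / (K + 1) by rewrite divr_gt0// subr_gt0.
exists ((h x - lam) / (K + 1)) => //= y; rewrite /ball /= ltr_pdivlMr// => hxy.
exists N, t, th; split => //; first by rewrite MN.
rewrite -/(h y).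
have := hL y; rewrite ler_norml => /andP[_ h1].
have : K * `|x - y| <= `|x - y| * (K + 1).
  by rewrite mulrDr mulr1 mulrC lerDl.
lra.
Qed.

Variables (mu : {measure set R -> \bar R}).

(** A bad point has, for some level [lam j], large waves beyond every [k]. In a unit window the
    weak-type bound passes to the increasing union over [n], and a suitable [k] makes it arbitrarily
    small. *)
Lemma bad_negligible (C : R) : 0 <= C ->
  (forall eps, 0 < eps -> exists2 k, (0 < k)%N &
     forall (lam n z : R) (O : set R), 0 < lam -> k%:R <= n -> measurable O ->
       O `<=` large_wave m gamma g1 g2 lam k%:R n ->
       (mu (O `&` `[z, (z + 1)%R[) <= (C * eps / lam ^+ 2)%:E)%E) ->
  mu.-negligible [set x | ~ uniformly_cauchy x].
Proof.
move=> C0 hmax.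
pose J (z : R) : set R := `[z, (z + 1)%R[%classic.
pose lam (j : nat) : R := j.+1%:R^-1.
have lam0 j : 0 < lam j by rewrite invr_gt0 ltr0n.
pose U j (k : nat) (n : nat) : set R :=
  [set x | large_wave m gamma g1 g2 (lam j) k%:R n%:R x].
have mU j k n : measurable (U j k n).
  by apply: open_measurable; apply: open_large_wave; rewrite ler0n.
pose V j z k := \bigcup_n (U j k n `&` J z).
have mUI j k n z : measurable (U j k n `&` J z).
  by apply: measurableI => //; exact: measurable_itv.
have mV j z k : measurable (V j z k) by apply: bigcup_measurable => n _.
have muV j z k e : (forall n : nat, (k <= n)%N ->
    (mu (U j k n `&` J z) <= e%:E)%E) -> (mu (V j z k) <= e%:E)%E.
  move=> hn.
  have nd : nondecreasing_seq (fun n => U j k n `&` J z).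
    apply/nondecreasing_seqP => n; rewrite subsetEset => x [[N [t [th [h1 h2 h3]]]] Jx].
    split => //; exists N, t, th; split => //.
    by case/andP: h1 => -> h /=; apply: le_trans h _; rewrite ler_nat.
  have cv : (mu \o (fun n => U j k n `&` J z)) n @[n --> \oo] --> mu (V j z k).
    apply: nondecreasing_cvg_mu => //; exact: (mV j z k).
  rewrite -(cvg_lim _ cv)//; apply: lime_le; first by apply/cvg_ex; eexists; exact: cv.
  by exists k => // n /= kn; exact: hn.
pose Z j z := \bigcap_k V j z k.+1.
have mZ j z : measurable (Z j z) by apply: bigcap_measurable => // k _; exact: mV.
have muZ j z : mu (Z j z) = 0%E.
  apply/eqP; rewrite eq_le measure_ge0 andbT.
  apply/lee_addgt0Pr => e e0; rewrite add0e.
  (* An energy this small brings the weak-type bound at level [lam j] below [e]; [C + 1] guards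
     against [C = 0]. *)
  have d0 : 0 < e * lam j ^+ 2 / (C + 1).
    by rewrite divr_gt0 ?mulr_gt0 ?exprn_gt0//; lra.
  have [[//|k] _ hk] := hmax _ d0.
  apply: (@le_trans _ _ (mu (V j z k.+1))).
    by apply: le_measure; rewrite ?inE// => x /(_ k I).
  apply: muV => n kn.
  have kn' : k.+1%:R <= n%:R :> R by rewrite ler_nat.
  apply: (le_trans (hk (lam j) n%:R z (U j k.+1 n) (lam0 j) kn' (mU _ _ _) _)) => //.
  rewrite lee_fin ler_pdivrMr ?exprn_gt0//.
  have C1 : 0 < C + 1 by lra.
  rewrite mulrCA ger_pMr ?mulr_gt0 ?exprn_gt0//.
  by rewrite ler_pdivrMr// mul1r lerDl.
(* Differences of naturals run through the integers, so the windows cover the line. *)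
pose W := \bigcup_j \bigcup_a \bigcup_b Z j (a%:R - b%:R).
apply: (@negligibleS _ _ _ mu W); last first.
  do 3 (apply: negligible_bigcup => ?).
  by apply/negligibleP; [exact: mZ|exact: muZ].
move=> x; apply: contra_notP => nW eps eps0.
pose j := Num.truncn eps^-1.
have lj : lam j <= eps.
  by rewrite /lam invf_ple ?posrE ?ltr0n// ltW// truncnS_gt.
pose b := (Num.truncn `|x|).+1.
have xb : - x < b%:R.
  by apply: le_lt_trans (ler_norm _) _; rewrite normrN truncnS_gt.
have xb0 : 0 <= x + b%:R by lra.
pose a := Num.truncn (x + b%:R).
have /andP[xa1 xa2] := truncn_itv xb0.
have Jx : J (a%:R - b%:R) x.
  rewrite /J /= in_itv /= /a; move: xa2; rewrite -natr1 => xa2.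
  by apply/andP; split; lra.
have [k nV] : exists k, ~ V j (a%:R - b%:R) k.+1 x.
  apply: contrapT => h; apply: nW; exists j => //; exists a => //; exists b => //.
  by move=> k _; apply: contrapT => h'; apply: h; exists k.
exists k.+1%:R; first by rewrite ler1n.
move=> N t th kN ht; rewrite leNgt; apply/negP => hP; apply: nV.
exists (Num.truncn N).+1 => //; split => //; exists N, t, th; split => //.
  by rewrite kN ltW// truncnS_gt.
exact: le_lt_trans hP.
Qed.

End Exceptional.

(** * Convergence off the exceptional set *)

Section ComplexLimit.
Variable R : realType.
Local Open Scope complex_scope.

Lemma normr_complex_le (a b : R) :
  `|(a +i* b : R[i])| <= (`|a| + `|b|)%:C.
Proof.
rewrite normc_def /= lecR.
apply: le_trans (_ : Num.sqrt ((`|a| + `|b|) ^+ 2) <= _); last first.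
  by rewrite sqrtr_sqr ger0_norm// addr_ge0.
rewrite ler_sqrt ?sqr_ge0// -(real_normK (num_real a)) -(real_normK (num_real b)).
have := mulr_ge0 (normr_ge0 a) (normr_ge0 b); rewrite !expr2; nra.
Qed.

Lemma cvg_complex (T : Type) (F : set_system T) (FF : Filter F)
    (u v : T -> R) (a b : R) :
  u x @[x --> F] --> a -> v x @[x --> F] --> b ->
  ((u x +i* v x : R[i]^o) @[x --> F]) --> (a +i* b : R[i]^o).
Proof.
move=> /cvgrPdist_le ua /cvgrPdist_le vb; apply/cvgrPdist_le => e.
(* A positive element of [R[i]] is a positive real. *)
rewrite ltcE /= => /andP[/eqP e0 e1].
have e2 : 0 < complex.Re e / 2 by rewrite divr_gt0.
have h1 := ua _ e2; have h2 := vb _ e2.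
apply: filterS2 h1 h2 => x h1 h2.
have -> : (a +i* b - (u x +i* v x) : R[i]) = (a - u x) +i* (b - v x) by [].
apply: le_trans (normr_complex_le _ _) _.
have -> : e = (complex.Re e)%:C by apply/eqP; rewrite eq_complex /= -e0 !eqxx.
rewrite lecR; lra.
Qed.

End ComplexLimit.

Section PointwiseConvergence.
Variables (R : realType) (m kappa C1 : R) (gamma : R -> R -> R) (x : R).
Hypotheses (hm : 1 < m) (hk : 0 < kappa) (C10 : 0 < C1).
Hypothesis gamma0 : gamma x 0 = x.
Hypothesis holder : forall t t' : R, -1 <= t <= 1 -> -1 <= t' <= 1 ->
  `|gamma x t - gamma x t'| <= C1 * `|t - t'| `^ kappa.
Variable f : R -> R[i]%C.
Local Notation leb := (@lebesgue_measure R).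
Local Notation g1 := (fun xi => complex.Re (fourier f xi)).
Local Notation g2 := (fun xi => complex.Im (fourier f xi)).
Hypotheses
  (ig1 : forall N, leb.-integrable `[- N, N] (EFin \o g1))
  (ig2 : forall N, leb.-integrable `[- N, N] (EFin \o g2)).
Hypothesis good : uniformly_cauchy m g1 g2 gamma x.

Local Notation F N t th :=
  (\int[leb]_(y in `[- N, N]) wave m g1 g2 (gamma x t) t th y).

(** Adding [pi] to the shift negates the wave, so the one-sided bounds at [th] and [th + pi]
    together bound the absolute value. *)
Lemma partial_integral_cauchy (eps : R) : 0 < eps -> exists2 M : R, 1 <= M &
  forall N t th : R, M <= N -> -1 <= t <= 1 -> `|F N t th - F M t th| <= eps.
Proof.
move=> eps0; have [M M1 hM] := good eps0; exists M => // N t th MN ht.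
have M0 : 0 <= M by lra.
have iw X T th' := @integrable_wave_segment R m g1 g2 ig1 ig2 N X T th'.
have h1 := hM N t th MN ht; have h2 := hM N t (th + pi) MN ht.
have e : \int[leb]_(y in annulus M N) wave m g1 g2 (gamma x t) t (th + pi) y =
    - \int[leb]_(y in annulus M N) wave m g1 g2 (gamma x t) t th y.
  rewrite -mulN1r -RintegralZl//; last 2 first.
  - exact: measurable_annulus.
  - exact: integrable_annulus_sub.
  apply: eq_Rintegral => y _; rewrite /wave.
  have -> : phase m (gamma x t) t (th + pi) y = phase m (gamma x t) t th y + pi.
    by rewrite /phase addrA.
  by rewrite cosDpi sinDpi; ring.
move: h1 h2; rewrite e Rintegral_annulus// => h1 h2.
by rewrite ler_norml; apply/andP; split; lra.
Qed.

Definition wave_limit (t th : R) : R := lim (F N t th @[N --> +oo]).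

Lemma wave_limit_cvg (t th : R) : -1 <= t <= 1 ->
  F N t th @[N --> +oo] --> wave_limit t th.
Proof.
move=> ht; apply/cauchy_cvgP; apply: cauchy_exP => eps eps0.
have e2 : 0 < eps / 2 by rewrite divr_gt0.
have [M M1 hM] := partial_integral_cauchy e2.
exists (F M t th); exists M; split; first exact: num_real.
move=> N MN /=; rewrite /ball /= distrC.
by apply: le_lt_trans (hM N t th (ltW MN) ht) _; lra.
Qed.

Lemma wave_limit_dist (eps : R) : 0 < eps -> exists2 M : R, 1 <= M &
  forall t th : R, -1 <= t <= 1 -> `|wave_limit t th - F M t th| <= eps.
Proof.
move=> eps0; have e2 : 0 < eps / 2 by rewrite divr_gt0.
have [M M1 hM] := partial_integral_cauchy e2; exists M => // t th ht.
have /cvgrPdist_le /(_ _ e2) [A [_ hA]] := @wave_limit_cvg t th ht.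
pose N := Num.max M (A + 1).
have MN : M <= N by rewrite le_max lexx.
have AN : A < N by rewrite lt_max ltrDl ltr01 orbT.
have h1 := hA N AN; have h2 := hM N t th MN ht.
have -> : wave_limit t th - F M t th =
  (wave_limit t th - F N t th) + (F N t th - F M t th) by ring.
by apply: le_trans (ler_normD _ _) _; move: h1 => /= h1; lra.
Qed.

(** A three-epsilon argument: the limit is uniformly close to a fixed truncation, which depends
    continuously on [t] through the Hoelder bound on the curve. *)
Lemma wave_limit_continuous (th : R) :
  wave_limit t th @[t --> 0] --> wave_limit 0 th.
Proof.
apply/cvgrPdist_le => eps eps0.
have e3 : 0 < eps / 3 by rewrite divr_gt0.
have [M M1 hM] := wave_limit_dist e3.
have M0 : 0 <= M by lra.
pose A := wave_mass g1 g2 M.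
have A0 : 0 <= A by exact: wave_mass_ge0.
pose K := (C1 * M + M `^ m) * A.
have K0 : 0 <= K.
  by rewrite mulr_ge0// addr_ge0 ?powR_ge0// mulr_ge0// ltW.
pose eta := Num.min 1 (eps / 3 / (K + 1)).
have K1 : 0 < K + 1 by lra.
have eta0 : 0 < eta by rewrite lt_min ltr01 divr_gt0.
(* Chosen so that [|t|] is below 1 and below [eta], and [|t| ^ kappa] is at most [eta]. *)
pose d := Num.min 1 (Num.min eta (eta `^ kappa^-1)).
have d0 : 0 < d by rewrite lt_min ltr01 /= lt_min eta0 powR_gt0.
exists d => //= t; rewrite /ball /= sub0r normrN lt_min => /andP[t1].
rewrite lt_min => /andP[t2 t3].
have ht : -1 <= t <= 1 by rewrite -ler_norml ltW.
have h0 : -1 <= (0 : R) <= 1 by rewrite lerN10 ler01.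
have tk : `|t| `^ kappa <= eta.
  have -> : eta = (eta `^ kappa^-1) `^ kappa.
    by rewrite -powRrM mulVf ?gt_eqF// powRr1// ltW.
  by apply: powR_le_base => //; exact: ltW.
have hF : `|F M t th - F M 0 th| <= eps / 3.
  apply: le_trans (wave_integral_lipschitz hm ig1 ig2 _ _ _ _ _ M0) _.
  rewrite subr0 -/A.
  have hg : `|gamma x t - gamma x 0| <= C1 * eta.
    apply: le_trans (holder ht h0) _; rewrite subr0 ler_wpM2l//; exact: ltW.
  apply: (@le_trans _ _ (eta * K)).
    rewrite /K mulrA ler_wpM2r// mulrDr; apply: lerD.
      by rewrite mulrA (mulrC eta) ler_wpM2r.
    by rewrite ler_wpM2r ?powR_ge0// ltW.
  apply: (@le_trans _ _ (eps / 3 / (K + 1) * (K + 1))).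
    apply: ler_pM; rewrite ?(ltW eta0)//; first by rewrite ge_min lexx orbT.
    by rewrite lerDl.
  by rewrite divfK// gt_eqF.
have h1 := hM t th ht; have h2 := hM 0 th h0.
have -> : wave_limit 0 th - wave_limit t th = (wave_limit 0 th - F M 0 th)
  - (F M t th - F M 0 th) - (wave_limit t th - F M t th) by ring.
apply: le_trans (ler_normB _ _) _.
apply: le_trans (lerD (ler_normB _ _) (lexx _)) _; lra.
Qed.

Local Open Scope complex_scope.
Local Notation c := ((2 * pi)^-1 : R).

Lemma cintegral_evolution (N t : R) :
  cintegral `[- N, N] (evolution_integrand m f t (gamma x t)) =
  (c * F N t 0) +i* (c * F N t (- (pi / 2))).
Proof.
have iw th := @integrable_wave_segment R m g1 g2 ig1 ig2 N (gamma x t) t th.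
rewrite /cintegral -!RintegralZl//.
congr (_ +i* _); apply: eq_Rintegral => y _;
  rewrite /evolution_integrand /expi /wave /phase;
  case: (fourier f y) => a b /=.
  by rewrite addr0; ring.
rewrite cosB sinB cos_pihalf sin_pihalf; ring.
Qed.

Lemma evolution_cvg (t : R) : -1 <= t <= 1 ->
  (cintegral `[- N, N] (evolution_integrand m f t (gamma x t)) : R[i]^o)
    @[N --> +oo] -->
  ((c * wave_limit t 0) +i* (c * wave_limit t (- (pi / 2))) : R[i]^o).
Proof.
move=> ht; under eq_fun do rewrite cintegral_evolution.
apply: cvg_complex; apply: cvgMr; exact: wave_limit_cvg.
Qed.

Lemma evolutionE (t : R) : -1 <= t <= 1 -> evolution m f t (gamma x t) =
  (c * wave_limit t 0) +i* (c * wave_limit t (- (pi / 2))).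
Proof.
move=> ht; rewrite /evolution /line_integral.
have h := @cvg_lim (R[i]^o) (@norm_hausdorff R[i] R[i]^o) _ _ _ _ _ (evolution_cvg ht).
exact: h.
Qed.

Lemma inversion_integrandE : inversion_integrand f x =
  evolution_integrand m f 0 (gamma x 0).
Proof.
apply/funext => xi; rewrite /inversion_integrand /evolution_integrand.
by rewrite gamma0 mul0r addr0.
Qed.

(** As [gamma x 0 = x], the point value is the evolution at time 0, and convergence is continuity of
    [wave_limit] at 0. *)
Lemma uniformly_cauchy_converges : converges_along gamma m f x.
Proof.
have h0 : -1 <= (0 : R) <= 1 by rewrite lerN10 ler01.
have near1 : \forall t \near (0 : R), -1 <= t <= 1.
  exists 1 => //= t; rewrite /ball /= sub0r normrN => /ltW.
  by rewrite ler_norml.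
have dn th : wave_limit t th @[t --> (0 : R)^'] --> wave_limit 0 th.
  by move=> P /(@wave_limit_continuous th) hP; exact: nbhs_dnbhs hP.
split.
- rewrite /line_integral_cvg inversion_integrandE.
  by apply/cvg_ex; eexists; exact: evolution_cvg.
- apply: nbhs_dnbhs; apply: filterS near1 => t ht.
  by apply/cvg_ex; eexists; exact: evolution_cvg.
rewrite /point_value inversion_integrandE -/(evolution m f 0 (gamma x 0)).
rewrite evolutionE//.
apply: cvg_trans (_ : _ --> _); last first.
  apply: (@cvg_complex R R (0 : R)^' _ (fun t => c * wave_limit t 0)
    (fun t => c * wave_limit t (- (pi / 2)))); apply: cvgMr.
    exact: dn.
  exact: dn.
apply: near_eq_cvg; apply: nbhs_dnbhs; apply: filterS near1 => t ht.
by rewrite evolutionE.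
Qed.

End PointwiseConvergence.

(** * The divergence set *)

Section FourierData.
Variable R : realType.
Implicit Types (f h : R -> R[i]%C) (s : R).
Local Notation leb := (@lebesgue_measure R).
Local Notation Re := (@complex.Re R).
Local Notation Im := (@complex.Im R).

Lemma normc_sqr (z : R[i]%C) : Normc.normc z ^+ 2 = Re z ^+ 2 + Im z ^+ 2.
Proof. by case: z => a b /=; rewrite sqr_sqrtr// addr_ge0 ?sqr_ge0. Qed.

(** True for every [f]: where no transform exists, [fourier f] is the default 0. *)
Lemma fourier_in_L2 f : in_L2 (fourier f).
Proof.
rewrite /fourier; case: xgetP => [g _ []//|_]; split.
  by split; exact: measurable_cst.
by rewrite /L2norm2; under eq_integral do rewrite Normc.normc0 expr0n /=;
  rewrite integral0 ltry.
Qed.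

Lemma measurable_sobolev_density s (g1 g2 : R -> R) :
  measurable_fun setT g1 -> measurable_fun setT g2 ->
  measurable_fun setT (sobolev_density s g1 g2).
Proof.
move=> m1 m2; apply: measurable_funM.
  apply: (measurableT_comp (measurable_powR s)).
  by apply: measurable_funD => //; exact: measurable_funX.
by apply: measurable_funD; exact: measurable_funX.
Qed.

(** Almost everywhere the density is the squared modulus of the transform of the Bessel potential
    [h], which is square integrable. *)
Lemma in_sobolev_integrable s f : in_sobolev s f ->
  leb.-integrable setT (EFin \o sobolev_density s
    (fun xi => Re (fourier f xi)) (fun xi => Im (fourier f xi))).
Proof.
move=> [_ [h [_ hae]]].
have [[m1 m2] _] := fourier_in_L2 f.
have [[n1 n2] hfin] := fourier_in_L2 h.
have mS := measurable_sobolev_density s m1 m2.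
apply/integrableP; split; first exact/measurable_EFinP.
apply: le_lt_trans hfin; rewrite le_eqVlt; apply/orP; left; apply/eqP.
rewrite /L2norm2; apply: ge0_ae_eq_integral => //.
- by apply: measurableT_comp => //; exact/measurable_EFinP.
- apply/measurable_EFinP; under eq_fun do rewrite normc_sqr.
  by apply: measurable_funD; exact: measurable_funX.
- by move=> x _; rewrite lee_fin sqr_ge0.
case: hae => Z [mZ Z0 subZ]; exists Z; split => //.
apply: subset_trans subZ => xi; apply: contra_not => /= e _.
rewrite ger0_norm ?sobolev_density_ge0// e Normc.normcM exprMn.
congr (_%:E); rewrite /sobolev_density; congr (_ * _); last by rewrite normc_sqr.
have w0 : 0 <= 1 + xi ^+ 2 by rewrite addr_ge0 ?sqr_ge0.
rewrite normc_sqr /= expr0n addr0 -[RHS]powR_mulrn ?powR_ge0// -powRrM.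
by congr (_ `^ _); field.
Qed.

End FourierData.

Section DivergenceSet.
Variables (R : realType) (m kappa s C1 C2 : R) (gamma : R -> R -> R).
Hypotheses (hm : 1 < m) (hk : 0 < kappa) (hs : 1 / 4 < s)
  (C10 : 0 < C1) (C20 : 0 < C2).
Hypothesis gamma0 : forall x, gamma x 0 = x.
Hypothesis holder : forall x t t' : R, -1 <= t <= 1 -> -1 <= t' <= 1 ->
  `|gamma x t - gamma x t'| <= C1 * `|t - t'| `^ kappa.
Hypothesis bilip : forall t x x' : R, -1 <= t <= 1 ->
  C2^-1 * `|x - x'| <= `|gamma x t - gamma x' t| <= C2 * `|x - x'|.
Variable f : R -> R[i]%C.
Hypothesis hf : in_sobolev s f.
Local Notation leb := (@lebesgue_measure R).
Local Notation g1 := (fun xi => complex.Re (fourier f xi)).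
Local Notation g2 := (fun xi => complex.Im (fourier f xi)).

Lemma sobolev_ge0 : 0 <= s.
Proof. by move: (hs); lra. Qed.

Lemma measurable_fourier : measurable_fun setT g1 /\ measurable_fun setT g2.
Proof. by have [] := fourier_in_L2 f. Qed.

Lemma integrable_fourier (N : R) : leb.-integrable `[- N, N] (EFin \o g1) /\
  leb.-integrable `[- N, N] (EFin \o g2).
Proof.
have [m1 m2] := measurable_fourier; have iG := in_sobolev_integrable hf.
split; first exact: (integrable_segment_g1 sobolev_ge0 m1 iG).
exact: (integrable_segment_g2 sobolev_ge0 m2 iG).
Qed.

Let ig1 N : leb.-integrable `[- N, N] (EFin \o g1).
Proof. by have [] := integrable_fourier N. Qed.

Let ig2 N : leb.-integrable `[- N, N] (EFin \o g2).
Proof. by have [] := integrable_fourier N. Qed.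

Lemma divergence_set_sub :
  divergence_set gamma m f `<=` [set x | ~ uniformly_cauchy m g1 g2 gamma x].
Proof.
move=> x; apply: contra_not.
exact: (uniformly_cauchy_converges hm hk C10 (gamma0 x) (holder x) ig1 ig2).
Qed.

(* For [s > 1/2] the kernel is bounded, so the duality bound already applies
   to a single point. *)
Lemma uniformly_cauchy_supercritical (x : R) : 1 / 2 < s ->
  uniformly_cauchy m g1 g2 gamma x.
Proof.
move=> s1 eps eps0; pose q := 2 * s.
have q1 : 1 < q by rewrite /q; lra.
have q0 : 0 < q by lra.
have K0 : 0 < q - 1 by lra.
have [m1 m2] := measurable_fourier; have iG := in_sobolev_integrable hf.
(* The kernel is at most [2 / (q - 1)] and the energy tail at most [eps / tau], so each term of the
   duality bound is at most [eps / 2]. *)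
pose tau := 2 / (q - 1) / eps.
have tau0 : 0 < tau by rewrite !divr_gt0.
have e0 : 0 < eps / tau by rewrite divr_gt0.
have [k [k0 hk']] := energy_tail sobolev_ge0 m1 m2 iG (lexx q) e0.
have k1 : 1 <= k%:R :> R by rewrite ler1n.
exists k%:R => // N t th kN ht.
have kpos : 0 < k%:R :> R by lra.
have [iE _] := integrable_energy sobolev_ge0 m1 m2 iG N k1 (lexx q).
have := wave_dual_bound m q0 ig1 ig2 (I := 'I_1) (fun=> 1) (fun=> gamma x t)
  (fun=> t) (fun=> th) k1 tau0 (fun=> lexx N) iE (hk' N kN).
rewrite !big_ord1 !mul1r !subrr minxx => h; apply: (le_trans h).
have N1 : 1 <= N by lra.
have osc := @osc_on_ge1 R q m 0 0 q1.
have oscN : osc_on q m (fun y => 1 <= y) (- 0) 0 (q - 1)^-1 by rewrite oppr0.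
have hker := @kernel_bound R q m 0 0 0 _ _ _ _ q0 kpos kN k1 N1 osc oscN.
have {}hker : kernel m q 0 0 0 k%:R N <= 2 / (q - 1).
  apply: (le_trans (ler_norm _)); apply: (le_trans hker); lra.
have e1 : tau / 2 * (eps / tau) = eps / 2 by field; rewrite gt_eqF.
have e2 : (2 * tau)^-1 * (2 / (q - 1)) = eps / 2.
  by rewrite /tau; field; rewrite !gt_eqF.
have : (2 * tau)^-1 * kernel m q 0 0 0 k%:R N <= eps / 2.
  by rewrite -e2 ler_wpM2l// invr_ge0 mulr_ge0// ltW.
rewrite e1; lra.
Qed.

(** The kernel bounds require [q < 1], so [q = 2 s] serves only for [s < 1 / 2]; at [s = 1 / 2] an
    exponent slightly below 1 is taken, using the room given by [0 < alpha]. *)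
Lemma exists_exponent (alpha : R) : s <= 1 / 2 -> 0 < alpha ->
  1 - 2 * s < alpha -> (1 - 2 * s) / (m * kappa) < alpha ->
  exists q, [/\ 1 / 2 < q, q < 1, q <= 2 * s, 1 - q < alpha &
    (1 - q) / (m * kappa) < alpha].
Proof.
move=> s2 a0 h1 h2; move: (hs) => hs'.
have mk0 : 0 < m * kappa by rewrite mulr_gt0//; apply: lt_trans hm.
have [s3|s3] := ltP s (1 / 2).
  by exists (2 * s); split => //; lra.
pose eta := Num.min (1 / 4) (Num.min (alpha / 2) (alpha * (m * kappa) / 2)).
have p0 : 0 < alpha * (m * kappa) by exact: mulr_gt0.
have eta0 : 0 < eta by rewrite !lt_min; apply/and3P; split; lra.
have e1 : eta <= 1 / 4 by rewrite ge_min lexx.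
have e2 : eta <= alpha / 2 by rewrite !ge_min lexx orbT.
have e3 : eta <= alpha * (m * kappa) / 2 by rewrite !ge_min lexx !orbT.
exists (1 - eta); split; try lra.
rewrite ltr_pdivrMr//; lra.
Qed.

Lemma divergence_set_null (alpha : R) (mu : {measure set R -> \bar R}) :
  alpha_dimensional alpha mu -> 0 < alpha ->
  Num.max (1 - 2 * s) ((1 - 2 * s) / (m * kappa)) < alpha ->
  mu_ext mu (divergence_set gamma m f) = 0%E.
Proof.
move=> [c hc] a0; rewrite gt_max => /andP[h1 h2].
suff : mu.-negligible [set x | ~ uniformly_cauchy m g1 g2 gamma x].
  (* The outer measure is monotone, so a measurable null set containing the divergence set is
     enough. *)
  move=> [B [mB B0 subB]]; apply/eqP; rewrite eq_le mu_ext_ge0// andbT.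
  rewrite -B0 -(measurable_mu_extE mu mB); apply: le_mu_ext.
  by apply: subset_trans subB; exact: divergence_set_sub.
have [s2|s2] := leP s (1 / 2); last first.
  apply: (negligibleS _ (negligible_set0 mu)) => x nx.
  by apply: nx; exact: uniformly_cauchy_supercritical.
have [q [q1 q2 q3 q4 q5]] := exists_exponent s2 a0 h1 h2.
pose beta := Num.max (1 - q) ((1 - q) / (m * kappa)).
have ba : beta < alpha by rewrite gt_max q4.
have b1 : 1 - q <= beta by rewrite le_max lexx.
have b2 : (1 - q) / (m * kappa) <= beta by rewrite le_max lexx orbT.
(* The constant in [alpha_dimensional] carries no sign; a nonnegative one is needed for the energy
   sums. *)
pose c' := Num.max c 0.
have c'0 : 0 <= c' by rewrite le_max lexx orbT.
have hmu (x r : R) : 0 < r -> (mu (ball x r) <= (c' * r `^ alpha)%:E)%E.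
  move=> r0; apply: (le_trans (hc x r r0)); rewrite lee_fin.
  by rewrite ler_wpM2r ?powR_ge0// le_max lexx.
have lower (t x x' : R) : -1 <= t <= 1 ->
    C2^-1 * `|x - x'| <= `|gamma x t - gamma x' t|.
  by move=> /(bilip x x') /andP[].
have upper (t x x' : R) : -1 <= t <= 1 ->
    `|gamma x t - gamma x' t| <= C2 * `|x - x'|.
  by move=> /(bilip x x') /andP[].
have [C C0 hC] := maximal_bound q1 q2 hm hk C10 C20 holder lower ig1 ig2
  c'0 ba b1 b2 hmu.
have [m1 m2] := measurable_fourier; have iG := in_sobolev_integrable hf.
apply: (bad_negligible hm ig1 ig2 C20 upper (ltW C0)) => eps eps0.
have [k [k0 hk']] := energy_tail sobolev_ge0 m1 m2 iG q3 eps0.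
exists k => // lam n z O lam0 kn mO Osub.
have k1 : 1 <= k%:R :> R by rewrite ler1n.
have [iE _] := integrable_energy sobolev_ge0 m1 m2 iG n k1 q3.
exact: (hC lam k%:R n eps z O lam0 k1 kn mO iE (hk' n kn) Osub).
Qed.

End DivergenceSet.

Theorem corollary3 (R : realType) (m kappa : R) (gamma : R -> R -> R) (s : R)
    (hm : 1 < m) (hkappa : 0 < kappa <= 1) (hgamma : Gamma kappa gamma)
    (hs : 1 / 4 < s) (f : R -> R[i]%C) (hf : in_sobolev s f) :
  (dim_c (divergence_set gamma m f)
     <= (Num.max (1 - 2 * s) ((1 - 2 * s) / (m * kappa)))%:E)%E.
Proof.
have [k0 _] := andP hkappa.
have [_ g0 [C1 [C2 [C10 C20 holder bilip]]]] := hgamma.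
apply: ge_ereal_sup => _ [alpha [/andP[a0 _] [mu [dmu [mu0 _]]]] <-].
(* An exponent above the threshold would force the measure [mu], which charges the divergence set,
   to vanish on it. *)
rewrite lee_fin leNgt; apply/negP => lt.
have := divergence_set_null hm k0 hs C10 C20 g0 holder bilip hf dmu a0 lt.
by move=> e; move: mu0; rewrite e ltxx.
Qed.
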